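(* Let $m\ge 2$ and $c>0$. For all integers $N\ge 0$, $k\ge 0$ and $1\le i\le d_k$, the even Clifford prolate spheroidal wave function $\psi_{2N,m}^{k,c,i}$ is an eigenfunction of the finite Fourier transformation $\mathcal{G}_c$, i.e. there is $\mu\in\mathbb{C}$ with $\mathcal{G}_c\psi_{2N,m}^{k,c,i}(x)=\mu\,\psi_{2N,m}^{k,c,i}(x)$ for $x\in B(1)$.
   Context: $\mathbb{R}_m$ (resp. $\mathbb{C}_m$) is the real (resp. complex) Clifford algebra generated by $e_1,\dots,e_m$ with $e_j^2=-1$, $e_ie_j=-e_je_i$ ($i\ne j$). A point $x\in\mathbb{R}^m$ is identified with $\sum_j e_jx_j$, so $x^2=-|x|^2$; $\langle x,y\rangle=\sum_j x_jy_j$ for vectors. Clifford conjugation $\lambda\mapsto\bar\lambda$ is the conjugate-linear anti-automorphism of $\mathbb{C}_m$ with $\overline{e_j}=-e_j$; $[\lambda]_0$ is the scalar part and $|\lambda|^2=[\bar\lambda\lambda]_0$. The Dirac operator is $\partial_x=\sum_j e_j\partial_{x_j}$ (acting from the left). $B(1)$ is the closed unit ball of $\mathbb{R}^m$. For $c\ge0$, $L_cf(x)=\partial_x\big((1-|x|^2)\partial_xf(x)\big)+4\pi^2c^2|x|^2f(x)$ on $B(1)$. $M_l^+(k)$ is the right $\mathbb{R}_m$-module of $\mathbb{R}_m$-valued polynomials on $\mathbb{R}^m$ that are homogeneous of degree $k$ and left monogenic ($\partial_xY=0$); it has rank $d_k=\frac{(m+k-2)!}{(m-2)!\,k!}$.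 Fix a basis $\{Y_k^i\}_{i=1}^{d_k}$ of it with $\int_{S^{m-1}}\overline{Y_k^i(\omega)}Y_k^j(\omega)\,d\omega=\delta_{ij}$. Even CPSWFs: the real numbers $\chi$ for which there is a nonzero $P\in C^\infty([0,1],\mathbb{R})$ with $L_c[P(|x|^2)Y_k^i(x)]=\chi P(|x|^2)Y_k^i(x)$ on $B(1)$ do not depend on $i$ and form a strictly increasing sequence $\chi_{0,m}^{k,c}<\chi_{2,m}^{k,c}<\chi_{4,m}^{k,c}<\cdots$; for $\chi=\chi_{2N,m}^{k,c}$ the function $P=P_{N,m}^{k,c}$ is unique up to a real factor, and $\psi_{2N,m}^{k,c,i}(x)=P_{N,m}^{k,c}(|x|^2)Y_k^i(x)$, normalised in $L^2(B(1))$. $\mathcal{G}_cf(x)=\chi_{B(1)}(x)\int_{B(1)}e^{2\pi ic\langle x,y\rangle}f(y)\,dy$ for $f\in L^2(B(1),\mathbb{C}_m)$ (in the exponent $i$ is the imaginary unit; $\chi_{B(1)}$ is the indicator function). *)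

(* Defs.v *)
From HB Require Import structures.
From mathcomp Require Import all_boot all_order all_algebra.
From mathcomp Require Import all_classical all_reals all_analysis.
From mathcomp Require Import ring complex.
From mathcomp Require mpoly.

Set Implicit Arguments.
Unset Strict Implicit.
Unset Printing Implicit Defensive.

Import Order.TTheory GRing.Theory Num.Theory.
Import numFieldNormedType.Exports.

Local Open Scope classical_set_scope.
Local Open Scope ring_scope.

(* An element of the Clifford algebra on m generators over K is the family of
   its coefficients in the basis e_A = e_{a_1} ... e_{a_h}, where
   A = {a_1 < ... < a_h} ranges over the subsets of 'I_m. *)
Definition clifford (K : Type) (m : nat) : Type := {ffun {set 'I_m} -> K}.

Definition symdiff (T : finType) (A B : {set T}) : {set T} :=
  ((A :\: B) :|: (B :\: A))%SET.

(* e_A e_B = (-1)^(clinv A B) e_(symdiff A B): the pairs b < a count the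
   transpositions needed to sort the generators, the pairs b = a come from
   e_a^2 = -1. *)
Definition clinv m (A B : {set 'I_m}) : nat :=
  #|[set p : 'I_m * 'I_m | [&& p.1 \in A, p.2 \in B & (p.2 <= p.1)%N]]%SET|.

Section CliffordRing.
Variables (K : comNzRingType) (m : nat).
Implicit Types (x y z : clifford K m) (A B C : {set 'I_m}).

HB.instance Definition _ :=
  GRing.Lmodule.copy (clifford K m) {ffun {set 'I_m} -> K^o}.

Definition clbase (A : {set 'I_m}) : clifford K m := [ffun B => (B == A)%:R].

Definition clmul (x y : clifford K m) : clifford K m :=
  [ffun C => \sum_A \sum_(B | symdiff A B == C)
               (-1) ^+ clinv A B * (x A * y B)].

Lemma in_symdiff A B i : (i \in symdiff A B) = (i \in A) (+) (i \in B).
Proof. by rewrite !inE; case: (i \in A); case: (i \in B). Qed.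

Lemma symdiffA A B C : symdiff A (symdiff B C) = symdiff (symdiff A B) C.
Proof. by apply/finset.setP => i; rewrite !in_symdiff addbA. Qed.

Lemma symdiffK A : cancel (symdiff A) (symdiff A).
Proof. by move=> B; apply/finset.setP => i; rewrite !in_symdiff addKb. Qed.

Lemma symdiff0s A : symdiff finset.set0 A = A.
Proof. by apply/finset.setP => i; rewrite in_symdiff inE. Qed.

Lemma symdiffs0 A : symdiff A finset.set0 = A.
Proof. by apply/finset.setP => i; rewrite in_symdiff inE addbF. Qed.

Lemma symdiffss A : symdiff A A = finset.set0.
Proof. by apply/finset.setP => i; rewrite in_symdiff inE addbb. Qed.

Lemma odd_clinv A B : odd (clinv A B) =
  \big[addb/false]_(p : 'I_m * 'I_m)
    [&& p.1 \in A, p.2 \in B & (p.2 <= p.1)%N].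
Proof.
rewrite /clinv -sum1_card big_mkcond /= (big_morph odd oddD (erefl _)).
by apply: eq_bigr => p _; rewrite inE; case: [&& _, _ & _].
Qed.

Lemma sgn_clinvDl A B C :
  (-1) ^+ clinv (symdiff A B) C = (-1) ^+ clinv A C * (-1) ^+ clinv B C :> K.
Proof.
rewrite -exprD -[LHS]signr_odd -[RHS]signr_odd oddD !odd_clinv -big_split /=.
congr (_ ^+ _); congr nat_of_bool; apply: eq_bigr => p _; rewrite in_symdiff.
by case: (_ \in A); case: (_ \in B); case: (_ \in C); case: (_ <= _)%N.
Qed.

Lemma sgn_clinvDr A B C :
  (-1) ^+ clinv A (symdiff B C) = (-1) ^+ clinv A B * (-1) ^+ clinv A C :> K.
Proof.
rewrite -exprD -[LHS]signr_odd -[RHS]signr_odd oddD !odd_clinv -big_split /=.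
congr (_ ^+ _); congr nat_of_bool; apply: eq_bigr => p _; rewrite in_symdiff.
by case: (_ \in A); case: (_ \in B); case: (_ \in C); case: (_ <= _)%N.
Qed.

Lemma clmulE x y C : clmul x y C =
  \sum_A (-1) ^+ clinv A (symdiff A C) * (x A * y (symdiff A C)).
Proof.
rewrite ffunE; apply: eq_bigr => A _; rewrite (big_pred1 (symdiff A C)) //.
by move=> B /=; apply/eqP/eqP => [<-|->]; rewrite symdiffK.
Qed.

Lemma clmulA : associative clmul.
Proof.
move=> x y z; apply/ffunP => D; rewrite !clmulE.
under eq_bigr => A _ do rewrite clmulE !mulr_sumr.
under [RHS]eq_bigr => E _ do rewrite clmulE mulr_suml mulr_sumr.
rewrite [RHS]exchange_big /=; apply: eq_bigr => A _.
rewrite [RHS](reindex_inj (can_inj (symdiffK A))) /=; apply: eq_bigr => B _.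
rewrite symdiffK -!symdiffA.
have -> : symdiff A (symdiff B D) = symdiff B (symdiff A D).
  by apply/finset.setP => i; rewrite !in_symdiff addbCA.
set C := symdiff B (symdiff A D).
have -> : symdiff A D = symdiff B C by rewrite symdiffK.
by rewrite sgn_clinvDl sgn_clinvDr; ring.
Qed.

Lemma clinv0s A : clinv finset.set0 A = 0%N.
Proof. by apply: eq_card0 => p; rewrite !inE. Qed.

Lemma clinvs0 A : clinv A finset.set0 = 0%N.
Proof. by apply: eq_card0 => p; rewrite !inE /= andbF. Qed.

Lemma clmul1l : left_id (clbase finset.set0) clmul.
Proof.
move=> x; apply/ffunP => C; rewrite clmulE (bigD1 finset.set0) //= big1 ?addr0.
  by rewrite ffunE eqxx mul1r symdiff0s clinv0s mul1r.
by move=> A /negPf A0; rewrite ffunE A0 mul0r mulr0.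
Qed.

Lemma clmul1r : right_id (clbase finset.set0) clmul.
Proof.
move=> x; apply/ffunP => C; rewrite clmulE (bigD1 C) //= big1 ?addr0.
  by rewrite symdiffss ffunE eqxx mulr1 clinvs0 mul1r.
move=> A AC; rewrite ffunE (_ : (_ == _) = false) ?mulr0 ?mulr0 //.
apply: contraNF AC => /eqP h.
by rewrite -[C](symdiffK A) h symdiffs0.
Qed.

Lemma clmulDl : left_distributive clmul +%R.
Proof.
move=> x y z; apply/ffunP => C; rewrite [RHS]ffunE !clmulE -big_split /=.
by apply: eq_bigr => A _; rewrite ffunE mulrDl mulrDr.
Qed.

Lemma clmulDr : right_distributive clmul +%R.
Proof.
move=> x y z; apply/ffunP => C; rewrite [RHS]ffunE !clmulE -big_split /=.
by apply: eq_bigr => A _; rewrite ffunE mulrDr mulrDr.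
Qed.

Lemma cl1_neq0 : clbase finset.set0 != 0.
Proof.
apply/eqP => /ffunP /(_ finset.set0); rewrite !ffunE eqxx => /eqP.
by rewrite oner_eq0.
Qed.

HB.instance Definition _ := GRing.Zmodule_isNzRing.Build (clifford K m)
  clmulA clmul1l clmul1r clmulDl clmulDr cl1_neq0.

Lemma clscalerAl (a : K) x y : a *: (x * y) = (a *: x) * y.
Proof.
apply/ffunP => C; rewrite [LHS]ffunE [in LHS]clmulE [RHS]clmulE scaler_sumr.
by apply: eq_bigr => A _; rewrite ffunE /GRing.scale /= -mulrA mulrCA.
Qed.

HB.instance Definition _ :=
  GRing.LSemiModule_isLSemiAlgebra.Build K (clifford K m) clscalerAl.

Lemma clscalerAr (a : K) x y : a *: (x * y) = x * (a *: y).
Proof.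
apply/ffunP => C; rewrite [LHS]ffunE [in LHS]clmulE [RHS]clmulE scaler_sumr.
apply: eq_bigr => A _; rewrite ffunE /GRing.scale /= mulrCA; congr (_ * _).
by rewrite mulrCA.
Qed.

HB.instance Definition _ :=
  GRing.LSemiAlgebra_isSemiAlgebra.Build K (clifford K m) clscalerAr.

Definition cle (j : 'I_m) : clifford K m := clbase [set j]%SET.

Lemma clbaseM A B :
  clbase A * clbase B = (-1) ^+ clinv A B *: clbase (symdiff A B).
Proof.
apply/ffunP => C; rewrite [LHS]clmulE !ffunE (bigD1 A) //= big1 ?addr0.
  rewrite !ffunE eqxx mul1r /GRing.scale /=.
  have -> : (symdiff A C == B) = (C == symdiff A B).
    by apply/eqP/eqP => [<-|->]; rewrite symdiffK.
  by case: eqP => [->|_]; rewrite ?symdiffK ?mulr0.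
by move=> D /negPf DA; rewrite ffunE DA mul0r mulr0.
Qed.

Lemma clinv1 (i j : 'I_m) : clinv [set i]%SET [set j]%SET = (j <= i)%N.
Proof.
rewrite /clinv; case: leqP => h.
  rewrite (_ : finset _ = [set (i, j)]%SET) ?cards1 //.
  apply/finset.setP => -[a b]; rewrite !inE /= xpair_eqE.
  by case: eqP => //= ->; case: eqP => //= ->; rewrite h.
apply: eq_card0 => -[a b]; rewrite !inE /=.
by case: eqP => //= ->; case: eqP => //= ->; rewrite leqNgt h.
Qed.

Lemma cle_sqr (j : 'I_m) : cle j * cle j = -1.
Proof. by rewrite clbaseM symdiffss clinv1 leqnn expr1 scaleN1r. Qed.

Lemma cle_anticomm (i j : 'I_m) : i != j -> cle i * cle j = - (cle j * cle i).
Proof.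
move=> ij; rewrite !clbaseM !clinv1.
have -> : symdiff [set j]%SET [set i]%SET = symdiff [set i]%SET [set j]%SET.
  by apply/finset.setP => k; rewrite !in_symdiff addbC.
rewrite -scaleNr; congr (_ *: _).
have : (i : nat) != j by [].
by case: ltngtP => // _ _; rewrite ?expr0 ?expr1 ?opprK.
Qed.

(* Clifford conjugation (over the reals): conj(e_A) is the inverse of e_A, and
   e_A^2 = (-1)^(clinv A A). *)
Definition clbar (x : clifford K m) : clifford K m :=
  [ffun A => (-1) ^+ clinv A A * x A].

Lemma clbar_cle j : clbar (cle j) = - cle j.
Proof.
apply/ffunP => A; rewrite !ffunE; case: eqP => [->|_]; last by rewrite mulr0 oppr0.
by rewrite clinv1 leqnn mulN1r.
Qed.

Lemma clbarM x y : clbar (x * y) = clbar y * clbar x.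
Proof.
apply/ffunP => C; rewrite [LHS]ffunE [in LHS]clmulE [RHS]clmulE mulr_sumr.
have sK : involutive (fun A => symdiff A C).
  by move=> A; apply/finset.setP => i; rewrite !in_symdiff -addbA addbb addbF.
rewrite [RHS](reindex_inj (can_inj sK)) /=; apply: eq_bigr => A _.
rewrite (sK A) !ffunE.
have [B ->] : exists B, C = symdiff A B.
  by exists (symdiff A C); rewrite symdiffK.
rewrite symdiffK sgn_clinvDl !sgn_clinvDr.
have sq : (-1) ^+ clinv A B * (-1) ^+ clinv A B = 1 :> K.
  by rewrite -exprD addnn -mul2n exprM sqrrN !expr1n.
transitivity ((-1) ^+ clinv B A * (((-1) ^+ clinv B B * y B)
  * ((-1) ^+ clinv A A * x A)) * ((-1) ^+ clinv A B * (-1) ^+ clinv A B)).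
  by ring.
by rewrite sq mulr1.
Qed.

Definition clscalar (x : clifford K m) : K := x finset.set0.

End CliffordRing.
Arguments clbase {K m} A.
Arguments cle {K m} j.

(* Lebesgue measure on R^n, points being n-tuples: R^0 is a point of mass 1 and
   R^(n+1) = R * R^n carries the product measure. *)
Section LebesgueTuple.
Variable R : realType.
Local Notation mR := (measurableTypeR R).

Definition cons_pair n (p : mR * n.-tuple mR) : n.+1.-tuple mR :=
  [tuple of p.1 :: p.2].

Lemma measurable_cons_pair n : measurable_fun [set: mR * n.-tuple mR]
  (@cons_pair n).
Proof. by apply: measurable_cons; [exact: measurable_fst|exact: measurable_snd]. Qed.

Section Step.
Variables (n : nat) (mu : {sigma_finite_measure set (n.-tuple mR) -> \bar R}).

Definition lebesgue_step : set (n.+1.-tuple mR) -> \bar R :=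
  pushforward ((@lebesgue_measure R) \x mu)%E (@cons_pair n).

Let lebesgue_step0 : lebesgue_step set0 = 0%E.
Proof. by rewrite /lebesgue_step /pushforward preimage_set0 measure0. Qed.

Let lebesgue_step_ge0 A : (0 <= lebesgue_step A)%E.
Proof. exact: (measure_ge0 ((@lebesgue_measure R) \x mu)%E). Qed.

Let lebesgue_step_semi_sigma_additive : semi_sigma_additive lebesgue_step.
Proof.
exact: (@measure_semi_sigma_additive _ _ _
  (measure_function_pushforward__canonical__measure_function_Measure
     ((@lebesgue_measure R) \x mu)%E (@measurable_cons_pair n))).
Qed.

HB.instance Definition _ := isMeasure.Build _ _ _ lebesgue_step
  lebesgue_step0 lebesgue_step_ge0 lebesgue_step_semi_sigma_additive.

Let uncons (t : n.+1.-tuple mR) : mR * n.-tuple mR :=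
  (thead t, [tuple of behead t]).

Let measurable_uncons : measurable_fun [set: n.+1.-tuple mR] uncons.
Proof.
apply/measurable_fun_pairP; split; first exact: measurable_tnth.
exact: measurable_behead.
Qed.

Let lebesgue_step_sigma_finite : sigma_finite [set: n.+1.-tuple mR] lebesgue_step.
Proof.
have /sigma_finiteP[F [TF ndF Foo]] := sigma_finiteT (@lebesgue_measure R).
have /sigma_finiteP[G [TG ndG Goo]] := sigma_finiteT mu.
exists (fun k => uncons @^-1` (F k `*` G k)).
  rewrite -preimage_bigcup -[LHS](preimage_setT uncons); congr (_ @^-1` _).
  rewrite -setXTT TF TG predeqE => -[x y]; split.
    move=> [/= [a _ Fx] [b _ Gy]]; exists (maxn a b) => //; split.
    - by move: x Fx; exact/subsetPset/ndF/leq_maxl.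
    - by move: y Gy; exact/subsetPset/ndG/leq_maxr.
  by move=> [a _ []/= ? ?]; split; exists a.
move=> k; have [mF Fk] := Foo k; have [mG Gk] := Goo k; split.
  by rewrite -[X in measurable X]setTI; apply: measurable_uncons => //;
    exact: measurableX.
rewrite /lebesgue_step /pushforward -comp_preimage.
rewrite (_ : uncons \o _ = id) ?preimage_id.
  by rewrite product_measure1E// lte_mul_pinfty// ge0_fin_numE.
apply/funext => -[a t] /=; rewrite /uncons /cons_pair theadE /=.
by congr pair; apply: val_inj.
Qed.

HB.instance Definition _ := Measure_isSigmaFinite.Build _ _ _ lebesgue_step
  lebesgue_step_sigma_finite.

End Step.

Fixpoint lebesgue_tuple n : {sigma_finite_measure set (n.-tuple mR) -> \bar R} :=
  if n is n'.+1 then lebesgue_step (lebesgue_tuple n') else dirac [tuple].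

End LebesgueTuple.

Definition clcomplex (R : realType) m (x : clifford R m) : clifford R[i] m :=
  [ffun A => (x A)%:C%C].

Definition dimM (m k : nat) : nat := ((m + k - 2)`! %/ ((m - 2)`! * k`!))%N.

Section Prolate.
Variables (R : realType) (m : nat).
Local Notation point := 'rV[R]_m.
Local Notation clR := (clifford R m).
Local Notation clC := (clifford R[i] m).

Definition dot (x y : point) : R := \sum_i x 0 i * y 0 i.

(* The norm provided by the library on 'rV[R]_m is the sup norm, whence the
   explicit Euclidean ball. *)
Definition B1 : set point := [set x | dot x x <= 1].

Definition point_of (t : m.-tuple R) : point := \row_i tnth t i.

Definition int_rV (D : set point) (f : point -> R) : R :=
  \int[lebesgue_tuple R m]_(t in point_of @^-1` D) f (point_of t).

(* Surface integral over the unit sphere: in polar coordinates,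
   int_B1 f(y/|y|) dy = int_0^1 r^(m-1) dr * int_S f = (1/m) * int_S f. *)
Definition int_sphere (f : point -> R) : R :=
  m%:R * int_rV B1 (fun y => f ((Num.sqrt (dot y y))^-1 *: y)).

Definition int_rVC (D : set point) (f : point -> R[i]) : R[i] :=
  (int_rV D (fun x => complex.Re (f x)) +i* int_rV D (fun x => complex.Im (f x)))%C.

Definition dirac_op (f : point -> clR) (x : point) : clR :=
  \sum_(j < m) cle j * [ffun A => 'D_(delta_mx 0 j) (fun y => f y A) x].

Definition Lc (c : R) (f : point -> clR) (x : point) : clR :=
  dirac_op (fun y => (1 - dot y y) *: dirac_op f y) x
  + (4 * pi ^+ 2 * c ^+ 2 * dot x x) *: f x.

Definition homog_poly (k : nat) (f : point -> R) : Prop :=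
  exists p : mpoly.dhomog m R k, forall x,
    f x = mpoly.meval (fun i => x 0 i) (mpoly.mpoly_of_dhomog p).

Definition Mplus (k : nat) (Y : point -> clR) : Prop :=
  (forall A, homog_poly k (fun x => Y x A)) /\ (forall x, dirac_op Y x = 0).

Definition is_basis_Mplus k (Y : 'I_(dimM m k) -> point -> clR) : Prop :=
  (forall i, Mplus k (Y i)) /\
  (forall F, Mplus k F -> exists! a : {ffun 'I_(dimM m k) -> clR},
     forall x, F x = \sum_i Y i x * a i).

Definition orthonormal_sphere (I : eqType) (Y : I -> point -> clR) : Prop :=
  forall i j, [ffun A => int_sphere (fun w => (clbar (Y i w) * Y j w) A)]
              = (i == j)%:R :> clR.

(* A function of class C^infinity on [0,1] is represented by a smooth extension
   to R; below it only matters through its values on [0,1]. *)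
Definition smooth (P : R -> R) : Prop :=
  forall n t, derivable (derive1n n P) t 1.

Definition radial (P : R -> R) (Y : point -> clR) (x : point) : clR :=
  P (dot x x) *: Y x.

Definition even_eigenfunction (c : R) (Y : point -> clR) (chi : R)
    (P : R -> R) : Prop :=
  [/\ smooth P, (exists2 t, 0 <= t <= 1 & P t != 0) &
      forall x, B1 x -> Lc c (radial P Y) x = chi *: radial P Y x].

Definition even_eigenvalues (c : R) (Y : point -> clR) : set R :=
  [set chi | exists P, even_eigenfunction c Y chi P].

(* chi is chi_(2N), the N-th term (from N = 0) of the increasing enumeration of
   the eigenvalues. *)
Definition is_even_eigenvalue (c : R) (Y : point -> clR) (N : nat) (chi : R) :
    Prop :=
  exists s : nat -> R, [/\ {homo s : p q / (p < q)%N >-> p < q},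
    range s = even_eigenvalues c Y & chi = s N].

Definition even_cpswf (c : R) (Y : point -> clR) (N : nat) (psi : point -> clR) :
    Prop :=
  exists chi P, [/\ is_even_eigenvalue c Y N chi, even_eigenfunction c Y chi P,
    (forall x, B1 x -> psi x = radial P Y x) &
    int_rV B1 (fun x => clscalar (clbar (psi x) * psi x)) = 1].

Definition Gc (c : R) (f : point -> clC) (x : point) : clC :=
  if dot x x <= 1 then
    [ffun A => int_rVC B1 (fun y =>
       (((cos (2 * pi * c * dot x y)) +i* (sin (2 * pi * c * dot x y)))%C
         *: f y) A)]
  else 0.

End Prolate.

(* Main.v *)
(* Write a = 2 pi c and psi(x) = P(|x|^2) Y(x). Since -d_x^2 is the Laplacian, the
   components of Y are harmonic. Integrating by parts on the ball, where the boundary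
   terms vanish, moves the degree of Y from the integrand to an antiderivative of P:
     int_B P(|y|^2) cos(a <x,y> + th) Y(y) dy
       = (-a/2)^k Y(x) int_B U_k(|y|^2) cos(a <x,y> + th + k pi/2) dy,
   where U_0 = P, U_(j+1)' = U_j and U_(j+1)(1) = 0. The eigenvalue equation of L_c is a
   second-order equation for P on [0,1]; integrating it k times from 1 gives one for U_k,
   which two more integrations by parts turn into an equation for the last integral as a
   function of s = |x| along a ray. It is the equation of P(s^2), singular at s = 0, whose
   regular solutions form a line. Hence the integral is a multiple of P(|x|^2), the factor
   being its value at x = 0 divided by P(0), which does not depend on the ray. *)
Require Import Defs.
From HB Require Import structures.
From mathcomp Require Import all_boot all_order all_algebra.
From mathcomp Require Import all_classical all_reals all_analysis measurable_realfun.
From mathcomp Require Import ring lra complex.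
From mathcomp Require mpoly.
Import (canonicals, coercions) mpoly.

Set Implicit Arguments.
Unset Strict Implicit.
Unset Printing Implicit Defensive.

Import Order.TTheory GRing.Theory Num.Theory.
Import numFieldNormedType.Exports.

Local Open Scope classical_set_scope.
Local Open Scope ring_scope.

(** * Derivatives and functions on the ball *)

(** What makes the two equations agree is a shift of dimension. For [P] the eigenvalue equation is
    that of a radial function in dimension m + 2k, visible in the constant [2 * m%:R + 4 * k%:R].
    Each integration lowers this constant by 4; after k of them it is 2m, exactly what cancels the
    dimension term that integration by parts over the ball of R^m produces. No constants of
    integration arise, because the leading coefficient t(1 - t) vanishes at 1 together with the
    antiderivatives. Division by s is avoided: a derivative along a ray brings out a factor s and
    replaces [U j] by [U j.+1], so three consecutive integrals satisfy a system with polynomial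
    coefficients. The phase th treats the real and imaginary parts of the Fourier kernel at once. *)

Lemma continuous_derive (R : realType) (f df : R -> R) :
  (forall t : R, is_derive t (1 : R) f (df t)) -> continuous f.
Proof.
move=> h t; apply: differentiable_continuous; apply/derivable1_diffP.
by have [] := h t.
Qed.

(** Settles the endpoints: the eigenvalue equation along a ray is obtained only after division by a
    power of [Num.sqrt t], and the energy estimate for the radial system degenerates at 1. *)
Lemma continuous_eq0_itv (R : realType) (f : R -> R) (a b : R) : a < b -> continuous f ->
  (forall x, a < x < b -> f x = 0) -> forall x, a <= x <= b -> f x = 0.
Proof.
move=> ab cf f0 x /andP[ax xb]; apply/eqP; apply: contraT => fx0.
have e0 : 0 < `|f x| by rewrite normr_gt0.
have /cvgrPdist_lt /(_ _ e0) [d /= d0 hd] := cf x.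
(* a point of the open interval within distance [d] of [x] *)
pose e := d / (d + (b - a)); pose s := x + e * ((a + b) / 2 - x).
have D0 : 0 < d + (b - a) by rewrite addr_gt0 ?subr_gt0.
have e_gt0 : 0 < e by rewrite divr_gt0.
have e_lt1 : e < 1 by rewrite ltr_pdivrMr // mul1r ltrDl subr_gt0.
have eD : e * d + e * (b - a) = d by rewrite -mulrDr divfK // gt_eqF.
have eb : 0 < e * (b - a) by rewrite mulr_gt0 // subr_gt0.
have ed : 0 < e * d by rewrite mulr_gt0.
have e1 : e * (x - a) <= x - a by rewrite ler_piMl ?subr_ge0 // ltW.
have e2 : e * (b - x) <= b - x by rewrite ler_piMl ?subr_ge0 // ltW.
have e3 : 0 <= e * (x - a) by rewrite mulr_ge0 ?subr_ge0 // ltW.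
have e4 : 0 <= e * (b - x) by rewrite mulr_ge0 ?subr_ge0 // ltW.
have sE : s = x + (e * (b - x) - e * (x - a)) / 2 by rewrite /s; field.
have eba : e * (b - a) = e * (b - x) + e * (x - a) by ring.
have fs : f s = 0 by apply: f0; rewrite sE; apply/andP; split; lra.
have := hd s; rewrite /= fs subr0 ltxx => H; suff: false by [].
by apply: H; rewrite /ball /= sE opprD addNKr normrN ltr_norml; apply/andP; split; lra.
Qed.

Section PointwiseDerivatives.
Variables (R : realType) (f g : R -> R) (t df dg a : R).
Hypotheses (hf : is_derive t (1 : R) f df) (hg : is_derive t (1 : R) g dg).

Lemma is_derive_add : is_derive t (1 : R) (fun s => f s + g s) (df + dg).
Proof. exact: is_deriveD. Qed.

Lemma is_derive_sub : is_derive t (1 : R) (fun s => f s - g s) (df - dg).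
Proof. exact: is_deriveB. Qed.

Lemma is_derive_mul : is_derive t (1 : R) (fun s => f s * g s) (f t * dg + g t * df).
Proof. exact: is_deriveM. Qed.

Lemma is_derive_scale : is_derive t (1 : R) (fun s => a * f s) (a * df).
Proof. exact: is_deriveZ. Qed.

End PointwiseDerivatives.

Section TameFunctions.
Variables (R : realType) (m : nat).
Local Notation point := 'rV[R]_m.
Implicit Types (f g h : point -> R) (x y : point).

Lemma dotZl (s : R) x y : dot (s *: x) y = s * dot x y.
Proof. by rewrite /dot mulr_sumr; apply: eq_bigr => j _; rewrite mxE mulrA. Qed.

Lemma dotZ (s : R) x : dot (s *: x) (s *: x) = s ^+ 2 * dot x x.
Proof. by rewrite /dot mulr_sumr; apply: eq_bigr => j _; rewrite !mxE; ring. Qed.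

Lemma dot_ge0 x : 0 <= dot x x.
Proof. by apply: sumr_ge0 => i _; rewrite -expr2 sqr_ge0. Qed.

Lemma dot_eq0 x : dot x x = 0 -> x = 0.
Proof.
move=> /psumr_eq0P h; apply/rowP => i; rewrite mxE.
by apply/eqP; rewrite -sqrf_eq0 expr2 h // => j _; rewrite -expr2 sqr_ge0.
Qed.

(* Continuity along coordinate lines, together with measurability and
   boundedness on the ball, is all that the integral formulas below need. *)
Definition tame f : Prop := [/\
  measurable_fun [set: m.-tuple (measurableTypeR R)]
    (fun t : m.-tuple (measurableTypeR R) => f (point_of t)),
  exists M, forall y, B1 y -> `|f y| <= M &
  forall y j, continuous (fun t : R => f (y + t *: delta_mx 0 j))].

(** A relation instead of ['D_], so that the existence of the derivative travels with its value. *)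
Definition partial (j : 'I_m) f g : Prop :=
  forall x, is_derive x (delta_mx 0 j) f (g x).

Lemma tame_cst (a : R) : tame (cst a).
Proof.
split; first exact: measurable_cst; first by exists `|a|.
by move=> y j t; exact: cvg_cst.
Qed.

Lemma B1_coord y j : B1 y -> `|y 0 j| <= 1.
Proof.
rewrite /B1 /dot /= (bigD1 j) //= => h.
rewrite -(@ler_pXn2r _ 2) ?nnegrE // expr1n.
rewrite real_normK ?num_real // expr2; apply: le_trans h; rewrite lerDl.
by apply: sumr_ge0 => i _; rewrite -expr2 sqr_ge0.
Qed.

Lemma tame_coord j : tame (fun y => y 0 j).
Proof.
split.
- rewrite (_ : (fun t => _) = fun t : m.-tuple (measurableTypeR R) => tnth t j).
    exact: measurable_tnth.
  by apply/funext => t; rewrite mxE.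
- by exists 1 => y /B1_coord.
move=> y i; rewrite (_ : (fun t => _) = fun t => y 0 j + t * (delta_mx 0 i : point) 0 j).
  move=> t; apply: cvgD; first exact: cvg_cst.
  by apply: cvgM; [exact: cvg_id|exact: cvg_cst].
by apply/funext => t; rewrite !mxE.
Qed.

Lemma tameD f g : tame f -> tame g -> tame (fun y => f y + g y).
Proof.
move=> [mf [M fM] cf] [mg [N gN] cg]; split.
- exact: measurable_funD.
- exists (M + N) => y By; apply: le_trans (ler_normD _ _) _.
  by rewrite lerD ?fM ?gN.
- by move=> y j t; apply: cvgD; [exact: cf|exact: cg].
Qed.

Lemma tameM f g : tame f -> tame g -> tame (fun y => f y * g y).
Proof.
move=> [mf [M fM] cf] [mg [N gN] cg]; split.
- exact: measurable_funM.
- exists (M * N) => y By; rewrite normrM.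
  by rewrite ler_pM ?fM ?gN.
- by move=> y j t; apply: cvgM; [exact: cf|exact: cg].
Qed.

Lemma tameZ a f : tame f -> tame (fun y => a * f y).
Proof. by move=> tf; apply: tameM => //; exact: tame_cst. Qed.

Lemma tame_comp (u : R -> R) f : continuous u -> tame f -> tame (fun y => u (f y)).
Proof.
move=> cu [mf [M fM] cf]; split.
- apply: (measurableT_comp (f := u)) => //; exact: continuous_measurable_fun.
(* Extreme value theorem on an interval containing the values of [f] on the ball; the maximum with 0
   makes it nonempty whatever [M] is. *)
- have [c _ ucP] : exists2 c, c \in `[- Num.max 0 M, Num.max 0 M]%R &
     forall t, t \in `[- Num.max 0 M, Num.max 0 M]%R -> `|u t| <= `|u c|.
    apply: (@EVT_max R (fun t => `|u t|)).
      by rewrite ge0_cp // le_max lexx.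
    apply: continuous_subspaceT => t; apply: cvg_norm; exact: cu.
  exists `|u c| => y By; apply: ucP; rewrite in_itv /= -ler_norml.
  by apply: le_trans (fM _ By) _; rewrite le_max lexx orbT.
- by move=> y j t; apply: (@continuous_comp R _ _ _ u); [exact: cf|exact: cu].
Qed.

Lemma tame_sum (I : Type) (r : seq I) (P : pred I) (F : I -> point -> R) :
  (forall i, P i -> tame (F i)) -> tame (fun y => \sum_(i <- r | P i) F i y).
Proof.
move=> tF; elim: r => [|i r IH].
  rewrite (_ : (fun y => _) = cst 0); first exact: tame_cst.
  by apply/funext => y; rewrite big_nil.
have [Pi|nPi] := boolP (P i).
  rewrite (_ : (fun y => _) = fun y => F i y + \sum_(j <- r | P j) F j y).
    by apply: tameD => //; exact: tF.
  by apply/funext => y; rewrite big_cons Pi.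
rewrite (_ : (fun y => _) = fun y => \sum_(j <- r | P j) F j y) //.
by apply/funext => y; rewrite big_cons (negbTE nPi).
Qed.

Lemma tame_dot x : tame (dot x).
Proof. by apply: tame_sum => i _; apply: tameZ; exact: tame_coord. Qed.

Lemma tame_sqnorm : tame (fun y => dot y y).
Proof. by apply: tame_sum => i _; apply: tameM; exact: tame_coord. Qed.

Lemma partial_cst j (a : R) : partial j (cst a) (cst 0).
Proof. by move=> x; exact: is_derive_cst. Qed.

Lemma partial_coord i j : partial j (fun y => y 0 i) (cst (i == j)%:R).
Proof.
move=> x; have lin : linear (fun y : point => y 0 i : R).
  by move=> a y z; rewrite !mxE.
have cE y : is_derive x (delta_mx 0 j) (fun y : point => y 0 i) ((delta_mx 0 j : point) 0 i).
  apply: DeriveDef.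
    by apply: diff_derivable; apply: differentiable_coord.
  rewrite deriveE; last exact: differentiable_coord.
  pose L : {linear point -> R} := HB.pack (fun y : point => y 0 i)
    (GRing.isLinear.Build _ _ _ _ _ lin).
  by rewrite (diff_lin (f := L)) //; exact: coord_continuous.
by apply: is_derive_eq (cE x) _; rewrite mxE eqxx eq_sym.
Qed.

Lemma partialD j f g df dg : partial j f df -> partial j g dg ->
  partial j (fun y => f y + g y) (fun y => df y + dg y).
Proof. by move=> hf hg x; apply: is_deriveD. Qed.

Lemma partialM j f g df dg : partial j f df -> partial j g dg ->
  partial j (fun y => f y * g y) (fun y => f y * dg y + g y * df y).
Proof. by move=> hf hg x; apply: is_deriveM. Qed.

Lemma partialZ j a f df : partial j f df ->
  partial j (fun y => a * f y) (fun y => a * df y).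
Proof. by move=> hf x; apply: is_deriveZ. Qed.

Lemma partial_sum j (I : Type) (r : seq I) (F dF : I -> point -> R) :
  (forall i, partial j (F i) (dF i)) ->
  partial j (fun y => \sum_(i <- r) F i y) (fun y => \sum_(i <- r) dF i y).
Proof.
move=> hF; elim: r => [|i r IH] x.
  rewrite big_nil (_ : (fun y => _) = cst 0); first exact: is_derive_cst.
  by apply/funext => y; rewrite big_nil.
rewrite big_cons (_ : (fun y => _) = fun y => F i y + \sum_(j <- r) F j y).
  by apply: is_deriveD; [exact: hF|exact: IH].
by apply/funext => y; rewrite big_cons.
Qed.

Lemma partial_unique j f g1 g2 : partial j f g1 -> partial j f g2 -> g1 =1 g2.
Proof. by move=> h1 h2 x; rewrite -(@derive_val _ _ _ _ _ _ _ (h1 x)) (@derive_val _ _ _ _ _ _ _ (h2 x)). Qed.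

(** Both difference quotients are the same function of [h], which reduces directional derivatives to
    one-variable calculus. *)
Lemma is_derive_line f x v (s d : R) : is_derive (x + s *: v) v f d <->
  is_derive s (1 : R) (fun t : R => f (x + t *: v)) d.
Proof.
have e : (fun h : R => h^-1 *: ((f \o shift (x + s *: v)) (h *: v) - f (x + s *: v))) =
   (fun h : R => h^-1 *: (((fun t : R => f (x + t *: v)) \o shift s) (h *: 1)
      - (fun t : R => f (x + t *: v)) s)).
  apply/funext => h /=; congr (_ *: (f _ - _)).
  by rewrite [h *: (1 : R)]mulr1 scalerDl addrCA.
split=> -[d1 d2]; split.
- by move: d1; rewrite /derivable e.
- by rewrite -d2 /derive e.
- by move: d1; rewrite /derivable e.
- by rewrite -d2 /derive e.
Qed.

(** The one-variable chain rule along the line through [x]; [f] is assumed to have this one partial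
    derivative, not to be differentiable. *)
Lemma partial_comp j (u du : R -> R) f df :
  (forall t : R, is_derive t (1 : R) u (du t)) -> partial j f df ->
  partial j (fun y => u (f y)) (fun y => du (f y) * df y).
Proof.
move=> hu hf x.
have := hf x; rewrite -[x in is_derive x _ _](addr0 x) -(scale0r (delta_mx 0 j)).
move=> /is_derive_line hf0.
rewrite -[x in is_derive x _ _](addr0 x) -(scale0r (delta_mx 0 j)); apply/is_derive_line.
have hu0 : is_derive ((fun t : R => f (x + t *: delta_mx 0 j)) 0) 1 u (du (f x)).
  by rewrite scale0r addr0; exact: hu.
by have := is_derive1_comp hu0 hf0.
Qed.

Lemma partial_dot j x : partial j (dot x) (cst (x 0 j)).
Proof.
have h : partial j (dot x) (fun y => \sum_i x 0 i * (i == j)%:R).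
  by apply: partial_sum => i; apply: partialZ; exact: partial_coord.
move=> y; apply: is_derive_eq (h y) _.
rewrite (bigD1 j) //= eqxx mulr1 big1 ?addr0 // => i /negPf ->.
by rewrite mulr0.
Qed.

Lemma partial_sqnorm j : partial j (fun y => dot y y) (fun y => 2 * y 0 j).
Proof.
have h : partial j (fun y => dot y y)
    (fun y => \sum_i (y 0 i * (i == j)%:R + y 0 i * (i == j)%:R)).
  by apply: partial_sum => i; apply: partialM; exact: partial_coord.
move=> y; apply: is_derive_eq (h y) _.
rewrite (bigD1 j) //= eqxx mulr1 big1 ?addr0 => [|i /negPf ->]; first by ring.
by rewrite mulr0 addr0.
Qed.

End TameFunctions.

(** * Polynomial functions *)

Section PolynomialFunctions.
Variables (R : realType) (m : nat).
Local Notation point := 'rV[R]_m.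
Local Notation mpol := (mpoly.mpoly m R).
Implicit Types (p q : mpol) (x y : point).

Definition polyf p y : R := mpoly.meval (fun i => y 0 i) p.

Lemma polyfX (i : 'I_m) y : polyf (mpoly.mpolyX R (mpoly.mnm1 i)) y = y 0 i.
Proof. exact: mpoly.mevalXU. Qed.

Lemma polyfD p q y : polyf (p + q) y = polyf p y + polyf q y.
Proof. exact: mpoly.mevalD. Qed.

Lemma polyfM p q y : polyf (p * q) y = polyf p y * polyf q y.
Proof. exact: mpoly.mevalM. Qed.

Lemma polyfZ a p y : polyf (a *: p) y = a * polyf p y.
Proof. exact: mpoly.mevalZ. Qed.

Lemma polyf_sum (I : Type) (r : seq I) (F : I -> mpol) y :
  polyf (\sum_(i <- r) F i) y = \sum_(i <- r) polyf (F i) y.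
Proof. exact: raddf_sum. Qed.

Lemma polyf1 y : polyf 1 y = 1.
Proof. exact: mpoly.meval1. Qed.

Lemma polyf0 y : polyf 0 y = 0.
Proof. exact: mpoly.meval0. Qed.

(** Induction along the generators of the algebra, suited to properties that products preserve, such
    as tameness and differentiability. *)
Lemma mpoly_closed_ind (S : mpol -> Prop) : S 1 ->
  (forall i, S (mpoly.mpolyX R (mpoly.mnm1 i))) ->
  (forall p q, S p -> S q -> S (p * q)) -> (forall p q, S p -> S q -> S (p + q)) ->
  (forall a p, S p -> S (a *: p)) -> forall p, S p.
Proof.
move=> S1 SX SM SD SZ; apply: mpoly.mpolyind.
  by rewrite -(scale0r (1 : mpol)); exact: SZ.
move=> a n p _ _ Sp; apply: SD => //; apply: SZ.
rewrite mpoly.mpolyXE_id; elim/big_ind: _ => // i _.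
by move: (mpoly.fun_of_multinom n i) => k; elim: k => [|k IH] //; rewrite exprS; exact: SM.
Qed.

Lemma tame_polyf p : tame (polyf p).
Proof.
elim/mpoly_closed_ind: p => [|i|p q tp tq|p q tp tq|a p tp].
- by rewrite (_ : polyf 1 = cst 1); [exact: tame_cst|apply/funext => y; exact: polyf1].
- rewrite (_ : polyf _ = fun y => y 0 i); first exact: tame_coord.
  by apply/funext => y; exact: polyfX.
- by rewrite (_ : polyf _ = fun y => polyf p y * polyf q y); [exact: tameM|apply/funext => y; exact: polyfM].
- by rewrite (_ : polyf _ = fun y => polyf p y + polyf q y); [exact: tameD|apply/funext => y; exact: polyfD].
- by rewrite (_ : polyf _ = fun y => a * polyf p y); [exact: tameZ|apply/funext => y; exact: polyfZ].
Qed.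

Lemma partial_polyf j p : partial j (polyf p) (polyf (mpoly.mderiv j p)).
Proof.
elim/mpoly_closed_ind: p => [|i|p q hp hq|p q hp hq|a p hp] x.
- rewrite (_ : polyf 1 = cst 1); last by apply/funext => y; exact: polyf1.
  apply: is_derive_eq (partial_cst j 1 x) _.
  by rewrite -[1 : mpol]/(mpoly.mpolyC m 1) mpoly.mderivC polyf0.
- rewrite (_ : polyf _ = fun y => y 0 i); last by apply/funext => y; exact: polyfX.
  apply: is_derive_eq (partial_coord i j x) _.
  rewrite mpoly.mderivX polyfZ mpoly.mnm1E; case: eqP => [->|_]; last by rewrite mul0r.
  rewrite mul1r (_ : mpoly.mnm_sub _ _ = mpoly.mnm0) ?mpoly.mpolyX0 ?polyf1 //.
  by apply/mpoly.mnmP => k; rewrite mpoly.mnmBE subnn mpoly.mnm0E.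
- rewrite (_ : polyf (p * q) = fun y => polyf p y * polyf q y); last by apply/funext => y; exact: polyfM.
  apply: is_derive_eq (partialM hp hq x) _.
  by rewrite mpoly.mderivM polyfD !polyfM addrC [polyf q x * _]mulrC.
- rewrite (_ : polyf (p + q) = fun y => polyf p y + polyf q y); last by apply/funext => y; exact: polyfD.
  by apply: is_derive_eq (partialD hp hq x) _; rewrite mpoly.mderivD polyfD.
- rewrite (_ : polyf (a *: p) = fun y => a * polyf p y); last by apply/funext => y; exact: polyfZ.
  by apply: is_derive_eq (partialZ a hp x) _; rewrite mpoly.mderivZ polyfZ.
Qed.

(** Goes through the analytic derivative, which depends on the values only; this spares the
    injectivity of polynomial evaluation. *)
Lemma polyf_mderiv_eq p q j : polyf p =1 polyf q ->
  polyf (mpoly.mderiv j p) =1 polyf (mpoly.mderiv j q).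
Proof.
move=> pq; apply: (@partial_unique _ _ j (polyf p)); first exact: partial_polyf.
by rewrite (_ : polyf p = polyf q); [exact: partial_polyf|apply/funext].
Qed.

Definition homogeneous d p : Prop :=
  forall n, n \in mpoly.msupp p -> mpoly.mdeg n = d.

Lemma homogeneous_dhomog d (p : mpoly.dhomog m R d) :
  homogeneous d (mpoly.mpoly_of_dhomog p).
Proof. by move=> n; exact: (mpoly.dhomogP _ _ _ (mpoly.dhomog_is_dhomog p)). Qed.

Lemma homogeneous_mderiv d p j : homogeneous d.+1 p -> homogeneous d (mpoly.mderiv j p).
Proof.
move=> hp n; rewrite mpoly.mcoeff_msupp mpoly.mcoeff_deriv => nz.
have /hp : mpoly.mnm_add n (mpoly.mnm1 j) \in mpoly.msupp p.
  by rewrite mpoly.mcoeff_msupp; apply: contraNneq nz => ->; rewrite mul0rn.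
by rewrite mpoly.mdegD mpoly.mdeg1 addn1 => -[].
Qed.

Lemma euler_identity d p y : homogeneous d p ->
  \sum_j y 0 j * polyf (mpoly.mderiv j p) y = d%:R * polyf p y.
Proof.
move=> hp; rewrite {2}[p]mpoly.mpolyE polyf_sum mulr_sumr.
under eq_bigr => j _ do rewrite /mpoly.mderiv polyf_sum mulr_sumr.
rewrite exchange_big /= big_seq [RHS]big_seq; apply: eq_bigr => n nin.
rewrite polyfZ -(hp _ nin) mpoly.mdegE natr_sum mulr_suml; apply: eq_bigr => j _.
(* When [n j] is 0, the truncated subtraction in the exponent is harmless because the coefficient
   vanishes. *)
rewrite polyfZ; have [->|n0] := eqVneq (n j) 0%N; first by rewrite !mul0r mulr0.
have -> : mpoly.mpolyX R n = mpoly.mpolyX R (mpoly.mnm1 j) *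
    mpoly.mpolyX R (mpoly.mnm_sub n (mpoly.mnm1 j)) :> mpol.
  rewrite -mpoly.mpolyXD mpoly.addmC mpoly.submK //.
  apply/mpoly.mnm_lepP => l; rewrite mpoly.mnm1E.
  by case: eqP => [<-|_] //; rewrite lt0n.
by rewrite polyfM polyfX; ring.
Qed.

Lemma polyf_homogeneous0 p x y : homogeneous 0 p -> polyf p x = polyf p y.
Proof.
move=> hp; rewrite [p]mpoly.mpolyE !polyf_sum big_seq [RHS]big_seq.
apply: eq_bigr => n /hp /eqP; rewrite mpoly.mdeg_eq0 => /eqP ->.
by rewrite !polyfZ mpoly.mpolyX0 !polyf1.
Qed.

Lemma polyf_homogeneousZ d p a y : homogeneous d p ->
  polyf p (a *: y) = a ^+ d * polyf p y.
Proof.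
move=> hp; rewrite [p]mpoly.mpolyE !polyf_sum big_seq [in RHS]big_seq mulr_sumr.
apply: eq_bigr => n /hp <-; rewrite !polyfZ mulrCA; congr (_ * _).
rewrite /polyf !mpoly.mevalX mpoly.mdegE -prodrXr -big_split /=.
by apply: eq_bigr => i _; rewrite mxE exprMn.
Qed.

End PolynomialFunctions.

(** * Integration over tuples and over the ball *)

Lemma integrable_bounded_support d (T : measurableType d) (R : realType)
    (mu : {measure set T -> \bar R}) (A : set T) (f : T -> R) (M : R) :
  measurable A -> (mu A < +oo)%E -> measurable_fun [set: T] f ->
  (forall t, `|f t| <= M) -> (forall t, ~ A t -> f t = 0) ->
  mu.-integrable [set: T] (EFin \o f).
Proof.
move=> mA Aoo mf fM f0.
have -> : EFin \o f = (EFin \o f) \_ A.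
  apply/funext => t; rewrite patchE; case: ifPn => // /negP tA /=.
  by rewrite f0 // => At; apply: tA; rewrite inE.
apply/(integrable_mkcond _ mA).
apply: (@measurable_bounded_integrable _ _ _ mu f A mA Aoo).
  exact: measurable_funTS.
by exists M; split; [exact: num_real|move=> x Mx t _; exact: le_trans (fM t) (ltW Mx)].
Qed.

Section LebesgueTupleIntegral.
Variable R : realType.
Local Notation mR := (measurableTypeR R).
Local Notation leb := (@lebesgue_measure R).

(** A set containing the ball which, unlike the ball, is a product: its finite measure follows by
    induction on [n], and its slices are of the same kind. *)
Definition tuple_cube n : set (n.-tuple mR) := [set t | forall i, `|tnth t i| <= 1].

Lemma measurable_tuple_cube n : measurable (@tuple_cube n).
Proof.
have -> : @tuple_cube n =
    \bigcap_(i in [set: 'I_n]) ((fun t : n.-tuple mR => tnth t i) @^-1` `[-1, 1]).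
  apply/seteqP; split=> t /=.
    by move=> h i _ /=; rewrite in_itv /= -ler_norml; exact: h.
  by move=> h i; have := h i I; rewrite /= in_itv /= -ler_norml.
apply: fin_bigcap_measurable => // i _; rewrite -[X in measurable X]setTI.
by apply: measurable_tnth => //; exact: measurable_itv.
Qed.

Lemma tuple_cube_cons n (p : mR * n.-tuple mR) :
  tuple_cube (cons_pair p) <-> `|p.1| <= 1 /\ tuple_cube p.2.
Proof.
split=> [h|[h1 h2] i].
  split=> [|i]; first by have := h ord0; rewrite /cons_pair tnth0.
  by have := h (lift ord0 i); rewrite /cons_pair tnthS.
by case: (unliftP ord0 i) => [j ->|->]; rewrite /cons_pair ?tnthS ?tnth0.
Qed.

Lemma lebesgue_tuple_cube n : (lebesgue_tuple R n (@tuple_cube n) < +oo)%E.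
Proof.
elim: n => [|n IH] /=.
  by rewrite diracE; case: (_ \in _); rewrite ltry.
rewrite /lebesgue_step /pushforward.
have -> : @cons_pair R n @^-1` @tuple_cube n.+1 = `[-1, 1]%classic `*` @tuple_cube n.
  apply/seteqP; split=> p /=.
    by move=> /tuple_cube_cons[h1 h2]; rewrite in_itv /= -ler_norml.
  by move=> [h1 h2]; apply/tuple_cube_cons; rewrite in_itv /= -ler_norml in h1.
rewrite product_measure1E //; last exact: measurable_tuple_cube.
rewrite lte_mul_pinfty //.
by rewrite -[X in X \is a fin_num]/(leb `[-1, 1]%classic) lebesgue_measure_itv /=; case: ifP.
Qed.

Section Slices.
Variables (n : nat) (f : n.+1.-tuple mR -> R) (M : R).
Hypotheses (mf : measurable_fun setT f) (fM : forall t, `|f t| <= M)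
  (f0 : forall t, ~ tuple_cube t -> f t = 0).

Let mf_cons : measurable_fun setT (f \o @cons_pair R n).
Proof. exact: measurableT_comp mf (@measurable_cons_pair R n). Qed.

Let integrable_cons : (leb \x lebesgue_tuple R n)%E.-integrable setT
  (EFin \o (f \o @cons_pair R n)).
Proof.
apply: (@integrable_bounded_support _ _ _ _ (@cons_pair R n @^-1` @tuple_cube n.+1) _ M).
- rewrite -[X in measurable X]setTI; apply: measurable_cons_pair => //.
  exact: measurable_tuple_cube.
- exact: (lebesgue_tuple_cube n.+1).
- exact: mf_cons.
- by move=> p; exact: fM.
- by move=> p np; exact: f0.
Qed.

Lemma integral_lebesgue_tupleS :
  (\int[lebesgue_tuple R n.+1]_t (f t)%:E =
   \int[leb \x lebesgue_tuple R n]_p (f (cons_pair p))%:E)%E.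
Proof.
rewrite /= /lebesgue_step.
rewrite (@integral_pushforward _ _ _ _ _ (@cons_pair R n)
  (@measurable_cons_pair R n) (leb \x lebesgue_tuple R n)%E setT (EFin \o f)) //.
by apply/measurable_EFinP.
Qed.

(** Both orders of Fubini are needed: this one to descend to a coordinate of the tail, the next one
    when the first coordinate is itself to be integrated first. *)
Lemma integral_lebesgue_tuple_head :
  (\int[lebesgue_tuple R n.+1]_t (f t)%:E =
   \int[leb]_s \int[lebesgue_tuple R n]_t (f (cons_pair (s, t)))%:E)%E.
Proof.
by rewrite integral_lebesgue_tupleS -(integral12_prod_meas1 integrable_cons).
Qed.

Lemma integral_lebesgue_tuple_tail :
  (\int[lebesgue_tuple R n.+1]_t (f t)%:E =
   \int[lebesgue_tuple R n]_t \int[leb]_s (f (cons_pair (s, t)))%:E)%E.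
Proof.
by rewrite integral_lebesgue_tupleS -(integral21_prod_meas1 integrable_cons).
Qed.

End Slices.

Definition set_coord n (t : n.-tuple mR) (j : 'I_n) (s : R) : n.-tuple mR :=
  [tuple (if i == j then s else tnth t i) | i < n].

(** Fubini for an arbitrary coordinate, by induction on the dimension. Speaking only of vanishing
    integrals avoids a measure on the coordinates other than [j]. *)
Lemma integral_slices_eq0 n (f : n.-tuple mR -> R) (M : R) (j : 'I_n) :
  measurable_fun setT f -> (forall t, `|f t| <= M) ->
  (forall t, ~ tuple_cube t -> f t = 0) ->
  (forall t, (\int[leb]_s (f (set_coord t j s))%:E = 0)%E) ->
  (\int[lebesgue_tuple R n]_t (f t)%:E = 0)%E.
Proof.
elim: n f j => [|n IH] f j; first by case: j.
move=> mf fM f0 h; case: (unliftP ord0 j) => [i ij|j0].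
  rewrite (integral_lebesgue_tuple_head mf fM f0).
  apply: integral0_eq => s _; apply: (IH (fun t => f (cons_pair (s, t))) i) => //.
  - apply: (measurableT_comp (f := f)) => //.
    exact: measurableT_comp (@measurable_cons_pair R n) (measurable_pair1 _).
  - by move=> t nt; apply: f0 => /tuple_cube_cons[].
  - move=> t; rewrite -(h (cons_pair (s, t))); apply: eq_integral => u _.
    congr ((f _)%:E); apply: eq_from_tnth => l; rewrite tnth_mktuple ij.
    case: (unliftP ord0 l) => [l' ->|->]; rewrite /cons_pair.
      by rewrite !tnthS /= tnth_mktuple (inj_eq lift_inj).
    by rewrite !tnth0.
rewrite (integral_lebesgue_tuple_tail mf fM f0).
(* The head 0 is a placeholder, overwritten by [set_coord]. *)
apply: integral0_eq => t _; rewrite -(h (cons_pair (0, t))).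
apply: eq_integral => u _; congr ((f _)%:E); apply: eq_from_tnth => l.
rewrite tnth_mktuple j0; case: (unliftP ord0 l) => [l' ->|->]; rewrite /cons_pair.
  by rewrite !tnthS.
by rewrite tnth0.
Qed.

End LebesgueTupleIntegral.

Lemma integral_itv_derivative (R : realType) (g dg : R -> R) (a b : R) : a <= b ->
  (forall s : R, is_derive s (1 : R) g (dg s)) -> continuous dg ->
  (\int[@lebesgue_measure R]_(s in `[a, b]) (dg s)%:E = (g b)%:E - (g a)%:E)%E.
Proof.
move=> ab hg cdg; have cg : continuous g.
  move=> s; apply: differentiable_continuous; apply/derivable1_diffP.
  by have [] := hg s.
(* The degenerate interval occurs for a line tangent to the sphere. *)
move: ab; rewrite le_eqVlt => /predU1P[->|ab].
  by rewrite set_itv1 integral_set1 -EFinB subrr.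
apply: continuous_FTC2 => //.
- by apply: continuous_subspaceT.
- split.
  + by move=> s _; have [] := hg s.
  + by apply: cvg_at_right_filter; exact: cg.
  + by apply: cvg_at_left_filter; exact: cg.
- by move=> s _; rewrite derive1E; have [_ ->] := hg s.
Qed.

Section BallIntegral.
Variables (R : realType) (m : nat).
Local Notation mR := (measurableTypeR R).
Local Notation point := 'rV[R]_m.
Local Notation ball_int := (int_rV (@B1 R m)).
Local Notation ball_dom := (@point_of R m @^-1` @B1 R m).
Implicit Types (f g h : point -> R) (x y : point).

Lemma measurable_unit_ball : measurable (ball_dom : set (m.-tuple mR)).
Proof.
have [mq _ _] := @tame_sqnorm R m.
have -> : ball_dom = (fun t : m.-tuple mR => dot (point_of t) (point_of t)) @^-1` `]-oo, 1].
  by apply/seteqP; split=> t /=; rewrite in_itv.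
by rewrite -[X in measurable X]setTI; apply: mq => //; exact: measurable_itv.
Qed.

Lemma ball_sub_cube : ball_dom `<=` @tuple_cube R m.
Proof. by move=> t /B1_coord Bt i; have := Bt i; rewrite mxE. Qed.

Lemma tame_integrable f : tame f ->
  (lebesgue_tuple R m).-integrable ball_dom
    (EFin \o (fun t : m.-tuple mR => f (point_of t))).
Proof.
move=> [mf [M fM] _]; apply/(integrable_mkcond _ measurable_unit_ball).
rewrite restrict_EFin.
apply: (@integrable_bounded_support _ _ _ _ (@tuple_cube R m) _ (Num.max 0 M)).
- exact: measurable_tuple_cube.
- exact: lebesgue_tuple_cube.
- apply/(measurable_restrictT _ measurable_unit_ball); exact: measurable_funTS.
- move=> t; rewrite patchE; case: ifPn => [|_]; last by rewrite normr0 le_max lexx.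
  by rewrite inE => /fM h; rewrite le_max h orbT.
- move=> t nt; rewrite patchE; case: ifPn => //; rewrite inE => /ball_sub_cube //.
Qed.

Lemma eq_ball f g : (forall y, B1 y -> f y = g y) -> ball_int f = ball_int g.
Proof. by move=> fg; apply: eq_Rintegral => t; rewrite inE => /fg. Qed.

Lemma ballD f g : tame f -> tame g ->
  ball_int (fun y => f y + g y) = ball_int f + ball_int g.
Proof.
by move=> tf tg; apply: RintegralD;
  [exact: measurable_unit_ball|exact: tame_integrable|exact: tame_integrable].
Qed.

Lemma ballZ (a : R) f : tame f -> ball_int (fun y => a * f y) = a * ball_int f.
Proof.
by move=> tf; apply: RintegralZl; [exact: measurable_unit_ball|exact: tame_integrable].
Qed.

Lemma ball_sum (I : Type) (r : seq I) (F : I -> point -> R) :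
  (forall i, tame (F i)) ->
  ball_int (fun y => \sum_(i <- r) F i y) = \sum_(i <- r) ball_int (F i).
Proof.
move=> tF; elim: r => [|i r IH].
  rewrite big_nil (_ : (fun y => _) = fun y => 0 * (cst 0 y)).
    by rewrite ballZ ?mul0r //; exact: tame_cst.
  by apply/funext => y; rewrite big_nil mul0r.
rewrite big_cons -IH -ballD //; last exact: tame_sum.
by apply: eq_ball => y _; rewrite big_cons.
Qed.

Lemma point_of_set_coord (t : m.-tuple mR) (j : 'I_m) (s : R) :
  point_of (set_coord t j s) = point_of (set_coord t j 0) + s *: delta_mx 0 j.
Proof.
apply/rowP => i; rewrite !mxE !tnth_mktuple eqxx /=.
by case: eqP => _; rewrite ?mulr1 ?mulr0 ?add0r ?addr0.
Qed.

Lemma dot_set_coord (t : m.-tuple mR) (j : 'I_m) (s : R) :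
  dot (point_of (set_coord t j s)) (point_of (set_coord t j s)) =
  dot (point_of (set_coord t j 0)) (point_of (set_coord t j 0)) + s ^+ 2.
Proof.
rewrite /dot (bigD1 j) //= [in RHS](bigD1 j) //= !mxE !tnth_mktuple eqxx.
rewrite mulr0 add0r addrC expr2; congr (_ + _); apply: eq_bigr => i /negPf ij.
by rewrite !mxE !tnth_mktuple ij.
Qed.

(** The divergence theorem for the field g e_j. A line parallel to the j-th axis meets the ball in a
    chord with both ends on the sphere, where [g] is 0, so the fundamental theorem of calculus gives
    0 on each line. *)
Lemma ball_derive j g dg : tame g -> tame dg -> partial j g dg ->
  (forall y, dot y y = 1 -> g y = 0) -> ball_int dg = 0.
Proof.
move=> tg [mdg [M dgM] cdg] hg g0; rewrite /int_rV Rintegral_mkcond /Rintegral.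
rewrite (@integral_slices_eq0 R m _ (Num.max 0 M) j) //.
- apply/(measurable_restrictT _ measurable_unit_ball); exact: measurable_funTS.
- move=> t; rewrite patchE; case: ifPn => [|_]; last by rewrite normr0 le_max lexx.
  by rewrite inE => /dgM h; rewrite le_max h orbT.
- by move=> t nt; rewrite patchE; case: ifPn => //; rewrite inE => /ball_sub_cube.
move=> t; set y0 := point_of (set_coord t j 0).
have [r1|r1] := leP (dot y0 y0) 1; last first.
  apply: integral0_eq => s _; rewrite patchE; case: ifPn => //.
  rewrite inE /= /B1 /= dot_set_coord -/y0 leNgt => /negP[].
  by apply: lt_le_trans r1 _; rewrite lerDl sqr_ge0.
(* Half the length of the chord, whose midpoint is [y0]. *)
pose b := Num.sqrt (1 - dot y0 y0).
have b2 : b ^+ 2 = 1 - dot y0 y0 by rewrite sqr_sqrtr // subr_ge0.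
transitivity (\int[@lebesgue_measure R]_(s in `[(- b)%R, b]) (dg (y0 + s *: delta_mx 0 j))%:E)%E.
  rewrite [RHS]integral_mkcond; apply: eq_integral => s _.
  rewrite !patchE point_of_set_coord -/y0.
  have -> : (set_coord t j s \in ball_dom) = (s \in `[- b, b]%classic).
    apply/idP/idP; rewrite !inE /= /B1 /= dot_set_coord -/y0 in_itv /= -ler_norml.
      by move=> h; rewrite -(@ler_pXn2r _ 2) ?nnegrE ?sqrtr_ge0 // real_normK ?num_real // b2 lerBrDl.
    by move=> h; rewrite -lerBrDl -b2 -[s ^+ 2]real_normK ?num_real // ler_pXn2r ?nnegrE ?sqrtr_ge0.
  by case: ifP.
have hl (s : R) : is_derive s (1 : R) (fun s => g (y0 + s *: delta_mx 0 j))
    (dg (y0 + s *: delta_mx 0 j)) by apply/is_derive_line.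
have lb : - b <= b by rewrite -subr_ge0 opprK addr_ge0 ?sqrtr_ge0.
rewrite (integral_itv_derivative lb hl (cdg _ _)).
have gb s : s ^+ 2 = b ^+ 2 -> g (y0 + s *: delta_mx 0 j) = 0.
  move=> sb; apply: g0; rewrite /y0 -point_of_set_coord dot_set_coord -/y0.
  by rewrite sb b2 addrC subrK.
by rewrite !gb ?sqrrN // subee.
Qed.

(** Integration by parts: the j-th derivative of Q(|y|^2) is 2 y_j W(|y|^2), and Q(|y|^2) vanishes
    on the sphere. *)
Lemma ball_coord j (Q W : R -> R) h dh :
  (forall t : R, is_derive t (1 : R) Q (W t)) -> continuous W -> Q 1 = 0 ->
  tame h -> tame dh -> partial j h dh ->
  ball_int (fun y => y 0 j * (W (dot y y) * h y)) =
  - 2^-1 * ball_int (fun y => Q (dot y y) * dh y).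
Proof.
move=> hQ cW Q1 th tdh hh; have cQ : continuous Q.
  move=> s; apply: differentiable_continuous; apply/derivable1_diffP.
  by have [] := hQ s.
have tq := @tame_sqnorm R m.
have tQ := tame_comp cQ tq; have tW := tame_comp cW tq.
have tP : tame (fun y : point => y 0 j * (W (dot y y) * h y)).
  by apply: tameM; [exact: tame_coord|exact: tameM].
have tR : tame (fun y : point => Q (dot y y) * dh y) by exact: tameM.
have : ball_int (fun y => Q (dot y y) * dh y + 2 * (y 0 j * (W (dot y y) * h y))) = 0.
  apply: (@ball_derive j (fun y => Q (dot y y) * h y)).
  - exact: tameM.
  - by apply: tameD => //; exact: tameZ.
  - move=> y; apply: is_derive_eq (partialM (partial_comp hQ (partial_sqnorm j)) hh y) _.
    by ring.
  - by move=> y ->; rewrite Q1 mul0r.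
rewrite ballD //; last exact: tameZ.
by rewrite ballZ // => e; lra.
Qed.

End BallIntegral.

(** * Integrals against plane waves *)

Section PlaneWaves.
Variables (R : realType) (m : nat).
Local Notation point := 'rV[R]_m.
Local Notation ball_int := (int_rV (@B1 R m)).
Implicit Types (x y : point) (th : R).

(** The phase closes the family under differentiation, which adds [pi / 2] to it; the phases 0 and
    [- (pi / 2)] give the cosine and the sine. *)
Definition wave x th y : R := cos (dot x y + th).

Lemma tame_wave x th : tame (wave x th).
Proof.
apply: (@tame_comp R m cos); first exact: continuous_cos.
by apply: tameD; [exact: tame_dot|exact: tame_cst].
Qed.

Lemma waveDpi2 x th y : wave x (th + pi / 2) y = - sin (dot x y + th).
Proof. by rewrite /wave addrA cosDpihalf. Qed.

Lemma waveDpi x th y : wave x (th + pi / 2 + pi / 2) y = - wave x th y.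
Proof.
by rewrite /wave (_ : _ + _ = dot x y + th + pi) ?cosDpi //; field.
Qed.

Lemma partial_wave j x th :
  partial j (wave x th) (fun y => x 0 j * wave x (th + pi / 2) y).
Proof.
have h : partial j (wave x th) (fun y => - sin (dot x y + th) * (x 0 j + 0)).
  apply: (@partial_comp R m j cos (fun t => - sin t)).
  by apply: partialD; [exact: partial_dot|exact: partial_cst].
by move=> y; apply: is_derive_eq (h y) _; rewrite waveDpi2; ring.
Qed.

Definition harmonic_poly (p : mpoly.mpoly m R) : Prop :=
  forall y, \sum_j polyf (mpoly.mderiv j (mpoly.mderiv j p)) y = 0.

Lemma harmonic_mderiv p i : harmonic_poly p -> harmonic_poly (mpoly.mderiv i p).
Proof.
move=> hp y; pose q := \sum_j mpoly.mderiv j (mpoly.mderiv j p).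
have q0 : polyf q =1 polyf 0.
  by move=> z; rewrite polyf_sum hp polyf0.
have := polyf_mderiv_eq i q0 y; rewrite mpoly.mderiv0 polyf0; apply: etrans.
rewrite /q (raddf_sum (mpoly.mderiv i)) polyf_sum; apply: eq_bigr => j _.
by rewrite (mpoly.mderiv_comm i j) (mpoly.mderiv_comm i j).
Qed.

Definition antiderivatives (U : nat -> R -> R) : Prop := continuous (U 0%N) /\
  forall j, (forall t : R, is_derive t (1 : R) (U j.+1) (U j t)) /\ U j.+1 1 = 0.

Lemma antiderivatives_continuous U j : antiderivatives U -> continuous (U j).
Proof.
by move=> [cU hU]; case: j => // j; apply: continuous_derive (hU j).1.
Qed.

(* Bochner's relation, with the radial transform on R^(m+2d) replaced by d-fold
   antiderivatives of the profile vanishing on the sphere. *)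
Lemma ball_harmonic U (hU : antiderivatives U) d p i x th :
  homogeneous d p -> harmonic_poly p ->
  ball_int (fun y => U i (dot y y) * (wave x th y * polyf p y)) =
  (- 2^-1) ^+ d * polyf p x *
  ball_int (fun y => U (i + d)%N (dot y y) * wave x (th + d%:R * (pi / 2)) y).
Proof.
have tU j : tame (fun y : point => U j (dot y y)).
  by apply: tame_comp; [exact: antiderivatives_continuous|exact: tame_sqnorm].
elim: d p i th => [|d IH] p i th hp Hp.
  rewrite expr0 mul1r mul0r addr0 addn0 -ballZ; last first.
    by apply: tameM => //; exact: tame_wave.
  by apply: eq_ball => y _; rewrite (polyf_homogeneous0 y x hp); ring.
have tw := tame_wave x; have tp := @tame_polyf R m.
have hd : (d.+1%:R : R) != 0 by rewrite pnatr_eq0.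
(* The degree is multiplied in so that Euler's identity can replace [p] by the sum of the y_j times
   its derivatives, which supplies the y_j needed for integration by parts. *)
apply: (mulfI hd).
rewrite -ballZ; last by apply: tameM => //; exact: tameM.
pose D j := mpoly.mderiv j p.
transitivity (\sum_j ball_int (fun y => y 0 j * (U i (dot y y) * (wave x th y * polyf (D j) y)))).
  rewrite -ball_sum; last first.
    by move=> j; apply: tameM; [exact: tame_coord|do 2!apply: tameM => //].
  apply: eq_ball => y _; rewrite mulrCA [_ * (wave _ _ _ * _)]mulrCA.
  rewrite -(euler_identity y hp) !mulr_sumr; apply: eq_bigr => j _.
  by rewrite /D; ring.
have step j : ball_int (fun y => y 0 j * (U i (dot y y) * (wave x th y * polyf (D j) y))) =
    - 2^-1 * (ball_int (fun y => U i.+1 (dot y y) * (wave x th y * polyf (mpoly.mderiv j (D j)) y)) +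
    x 0 j * ball_int (fun y => U i.+1 (dot y y) * (wave x (th + pi / 2) y * polyf (D j) y))).
  have th1 : tame (fun y => wave x th y * polyf (D j) y) by exact: tameM.
  have th2 : tame (fun y => wave x th y * polyf (mpoly.mderiv j (D j)) y +
      polyf (D j) y * (x 0 j * wave x (th + pi / 2) y)).
    by apply: tameD; apply: tameM => //; exact: tameZ.
  have hh := partialM (partial_wave j x th) (partial_polyf j (D j)).
  rewrite (ball_coord (hU.2 i).1 (antiderivatives_continuous hU) (hU.2 i).2 th1 th2 hh).
  congr (_ * _); rewrite -ballZ; last by do 2!apply: tameM => //.
  rewrite -ballD; last 2 first.
    by do 2!apply: tameM => //.
    by apply: tameZ; do 2!apply: tameM => //.
  by apply: eq_ball => y _; ring.
have IHD j := IH (D j) i.+1 (th + pi / 2) (homogeneous_mderiv hp) (harmonic_mderiv j Hp).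
under eq_bigr => j _ do rewrite step IHD.
rewrite -mulr_sumr big_split /= -ball_sum; last first.
  by move=> j; do 2!apply: tameM => //.
(* The terms where the derivative fell on [D j] add up to the Laplacian of [p]; only those where it
   fell on the wave survive. *)
rewrite (_ : ball_int _ = 0) ?add0r; last first.
  rewrite (@eq_ball _ _ _ (fun y => 0 * cst 0 y)) ?ballZ ?mul0r //; first exact: tame_cst.
  by move=> y _; rewrite mul0r -!mulr_sumr Hp !mulr0.
rewrite addSn -addnS.
have -> : th + pi / 2 + d%:R * (pi / 2) = th + d.+1%:R * (pi / 2).
  by rewrite -natr1; ring.
under eq_bigr => j _ do rewrite !mulrA -[X in X * ball_int _]mulrA.
rewrite -mulr_suml -/(D _) !mulrA; congr (_ * _).
under eq_bigr => j _ do rewrite mulrCA.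
(* Euler's identity again, now at [x], rebuilds [p] from its derivatives and returns the factor to
   be cancelled. *)
by rewrite -mulr_sumr (euler_identity x hp) exprS; ring.
Qed.

End PlaneWaves.

(** * Moments and ray derivatives of wave integrals *)

Section WaveIntegrals.
Variables (R : realType) (m : nat).
Local Notation point := 'rV[R]_m.
Local Notation ball_int := (int_rV (@B1 R m)).
Implicit Types (x y w : point) (th : R) (f W : R -> R).

Definition wave_int f x th : R := ball_int (fun y => f (dot y y) * wave x th y).

Lemma tame_radial_wave f x th : continuous f ->
  tame (fun y : point => f (dot y y) * wave x th y).
Proof.
move=> cf; apply: tameM; last exact: tame_wave.
by apply: tame_comp => //; exact: tame_sqnorm.
Qed.

Lemma wave_intD f g x th : continuous f -> continuous g ->
  wave_int (fun t => f t + g t) x th = wave_int f x th + wave_int g x th.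
Proof.
move=> cf cg; rewrite /wave_int -ballD; [|exact: tame_radial_wave..].
by apply: eq_ball => y _; rewrite mulrDl.
Qed.

Lemma wave_intZ a f x th : continuous f ->
  wave_int (fun t => a * f t) x th = a * wave_int f x th.
Proof.
move=> cf; rewrite /wave_int -ballZ; last exact: tame_radial_wave.
by apply: eq_ball => y _; rewrite mulrA.
Qed.

Lemma eq_wave_int f g x th : (forall t, 0 <= t <= 1 -> f t = g t) ->
  wave_int f x th = wave_int g x th.
Proof.
by move=> fg; apply: eq_ball => y By; rewrite fg // dot_ge0.
Qed.

Lemma ball_coord_wave (V W : R -> R) x th j :
  (forall t : R, is_derive t (1 : R) V (W t)) -> continuous W -> V 1 = 0 ->
  ball_int (fun y => y 0 j * (W (dot y y) * wave x th y)) =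
  - 2^-1 * (x 0 j * wave_int V x (th + pi / 2)).
Proof.
move=> hV cW V1; have cV := continuous_derive hV.
rewrite (ball_coord hV cW V1 (@tame_wave R m x th) _ (@partial_wave R m j x th)); last first.
  by apply: tameZ; exact: tame_wave.
congr (_ * _); rewrite /wave_int -ballZ; last exact: tame_radial_wave.
by apply: eq_ball => y _; rewrite mulrCA.
Qed.

(** With t = |y|^2 as the sum of the y_j^2, each factor y_j is integrated by parts. The first
    derivative falls on the other y_j, giving [m] in total, or on the wave; in the latter case the
    second y_j is integrated too, and the two phase shifts amount to a sign. *)
Lemma wave_int_mulX (W IW IIW : R -> R) x th : continuous W ->
  (forall t : R, is_derive t (1 : R) IW (W t)) -> IW 1 = 0 ->
  (forall t : R, is_derive t (1 : R) IIW (IW t)) -> IIW 1 = 0 ->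
  wave_int (fun t => t * W t) x th =
  - 2^-1 * (m%:R * wave_int IW x th + dot x x / 2 * wave_int IIW x th).
Proof.
move=> cW hIW IW1 hIIW IIW1.
have cIW := continuous_derive hIW; have cIIW := continuous_derive hIIW.
have tw := @tame_wave R m x.
have tq (V : R -> R) : continuous V -> tame (fun y : point => V (dot y y)).
  by move=> cV; apply: tame_comp => //; exact: tame_sqnorm.
have tyw th' j : tame (fun y : point => y 0 j * wave x th' y).
  by apply: tameM => //; exact: tame_coord.
have step j : ball_int (fun y => y 0 j * (W (dot y y) * (y 0 j * wave x th y))) =
   - 2^-1 * (wave_int IW x th + x 0 j * x 0 j * (2^-1 * wave_int IIW x th)).
  have hh := partialM (partial_coord j j) (partial_wave j x th).
  rewrite (ball_coord hIW cW IW1 (tyw th j) _ hh); last first.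
    by apply: tameD; apply: tameM => //; [exact: tame_coord|exact: tameZ|exact: tame_cst].
  congr (_ * _).
  transitivity (ball_int (fun y => IW (dot y y) * wave x th y +
      x 0 j * (y 0 j * (IW (dot y y) * wave x (th + pi / 2) y)))).
    by apply: eq_ball => y _; rewrite eqxx /=; ring.
  rewrite ballD; last 2 first.
    exact: tame_radial_wave.
    by apply: tameZ; apply: tameM; [exact: tame_coord|exact: tame_radial_wave].
  rewrite ballZ; last by apply: tameM; [exact: tame_coord|exact: tame_radial_wave].
  rewrite (ball_coord_wave x (th + pi / 2) j hIIW cIW IIW1) /wave_int.
  rewrite (_ : ball_int (fun y => IIW _ * wave x (th + pi / 2 + pi / 2) y) =
    -1 * ball_int (fun y => IIW (dot y y) * wave x th y)); first by ring.
  rewrite -ballZ; last exact: tame_radial_wave.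
  by apply: eq_ball => y _; rewrite waveDpi; ring.
transitivity (\sum_j ball_int (fun y => y 0 j * (W (dot y y) * (y 0 j * wave x th y)))).
  rewrite -ball_sum; last first.
    by move=> j; apply: tameM; [exact: tame_coord|apply: tameM => //; exact: tq].
  apply: eq_ball => y _; rewrite {1}/dot !mulr_suml; apply: eq_bigr => j _.
  by ring.
rewrite (eq_bigr _ (fun j _ => step j)) -mulr_sumr big_split /= sumr_const card_ord.
by rewrite -mulr_suml -/(dot x x) -mulr_natl; ring.
Qed.

(** Differentiating the wave brings out <w,y>; integrating each y_j by parts turns it into s w_j and
    passes from [W] to its antiderivative. *)
Lemma is_derive_wave_int_ray (V W : R -> R) w th (s : R) :
  (forall t : R, is_derive t (1 : R) V (W t)) -> continuous W -> V 1 = 0 ->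
  is_derive s (1 : R) (fun s => wave_int W (s *: w) th)
    (2^-1 * s * dot w w * wave_int V (s *: w) th).
Proof.
move=> hV cW V1; have cV := continuous_derive hV.
pose F (u : R) (t : m.-tuple (measurableTypeR R)) : R :=
  W (dot (point_of t) (point_of t)) * wave (u *: w) th (point_of t).
have dF (u : R) t : is_derive u (1 : R) (F ^~ t)
    (W (dot (point_of t) (point_of t)) *
      (- sin (dot (u *: w) (point_of t) + th) * dot w (point_of t))).
  rewrite (_ : F ^~ t = fun u => W (dot (point_of t) (point_of t)) *
      cos (u * dot w (point_of t) + th)); last first.
    by apply/funext => v; rewrite /F /wave dotZl.
  rewrite dotZl; set b := dot w _; set v := u * b + th.
  have h1 : is_derive u (1 : R) (fun u => u * b + th) b.
    have h : is_derive u (1 : R) (fun u => b * u + th) (b * 1 + 0).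
      exact: (is_deriveD (is_deriveZ b (is_derive_id u (1 : R))) (is_derive_cst th u 1)).
    rewrite mulr1 addr0 in h; rewrite (_ : (fun u => _) = fun u => b * u + th) //.
    by apply/funext => z; rewrite mulrC.
  have := @is_deriveZ R R R (fun u => cos (u * b + th)) (W (dot (point_of t) (point_of t))) u 1 _
     (@is_derive1_comp R cos (fun u => u * b + th) u _ _ (is_derive_cos _) h1).
  by [].
have tB : tame (fun y : point => W (dot y y) * dot w y).
  by apply: tameM; [apply: tame_comp => //; exact: tame_sqnorm|exact: tame_dot].
have [_ [M hM] _] := tB.
have su : s \in `]s - 1, s + 1[ by rewrite in_itv /=; apply/andP; split; lra.
have iF (u : R) : (lebesgue_tuple R m).-integrable (@point_of R m @^-1` @B1 R m) (EFin \o F u).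
  exact: (@tame_integrable R m _ (tame_radial_wave (u *: w) th cW)).
have F1 (u : R) t : partial1of2 F u t = W (dot (point_of t) (point_of t)) *
      (- sin (dot (u *: w) (point_of t) + th) * dot w (point_of t)).
  by rewrite partial1of2E; have [_ ->] := dF u t.
(* Domination by a constant: the sine is at most 1 in absolute value and [M] bounds the remaining
   factor on the ball. *)
have bF (u : R) (t : m.-tuple (measurableTypeR R)) : [set` `]s - 1, s + 1[] u ->
  (@point_of R m @^-1` @B1 R m) t -> `|partial1of2 F u t| <= `|M|.
  move=> _ Bt; rewrite F1 mulrCA normrM normrN.
  apply: (@le_trans _ _ (1 * `|W (dot (point_of t) (point_of t)) * dot w (point_of t)|)).
    by apply: ler_wpM2r => //; rewrite ler_norml sin_geN1 sin_le1.
  by rewrite mul1r; apply: le_trans (hM _ Bt) (ler_norm _).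
have iM : (lebesgue_tuple R m).-integrable (@point_of R m @^-1` @B1 R m)
    (EFin \o (fun t : m.-tuple (measurableTypeR R) => `|M|)).
  exact: (@tame_integrable R m (cst `|M|) (tame_cst _ _)).
have dvF (u : R) t : [set` `]s - 1, s + 1[] u ->
  (@point_of R m @^-1` @B1 R m) t -> derivable (F ^~ t) u 1.
  by move=> _ _; have [] := dF u t.
have := derivable_under_integral (mu := lebesgue_tuple R m) (f := F) (@measurable_unit_ball R m)
  su (fun u _ => iF u) dvF (fun _ => normr_ge0 M) iM bF.
have := differentiation_under_integral (mu := lebesgue_tuple R m) (f := F) (@measurable_unit_ball R m)
  su (fun u _ => iF u) dvF (fun _ => normr_ge0 M) iM bF.
rewrite derive1E => e1 e2; apply: DeriveDef; first exact: e2.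
apply: (etrans e1).
transitivity (ball_int (fun y => \sum_j w 0 j * (y 0 j * (W (dot y y) * wave (s *: w) (th + pi / 2) y)))).
  apply: eq_Rintegral => t _; rewrite F1 waveDpi2.
  rewrite [dot w _]/dot mulrA mulr_sumr; apply: eq_bigr => j _; ring.
rewrite ball_sum; last first.
  by move=> j; apply: tameZ; apply: tameM; [exact: tame_coord|exact: tame_radial_wave].
have step j : ball_int (fun y => w 0 j * (y 0 j * (W (dot y y) * wave (s *: w) (th + pi / 2) y))) =
    w 0 j * w 0 j * (2^-1 * s * wave_int V (s *: w) th).
  rewrite ballZ; last by apply: tameM; [exact: tame_coord|exact: tame_radial_wave].
  rewrite (ball_coord_wave _ _ j hV cW V1) /wave_int.
  rewrite (_ : ball_int (fun y => V _ * wave _ (th + pi / 2 + pi / 2) y) =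
    -1 * ball_int (fun y => V (dot y y) * wave (s *: w) th y)).
    by rewrite mxE; ring.
  rewrite -ballZ; last exact: tame_radial_wave.
  by apply: eq_ball => y _; rewrite waveDpi; ring.
by rewrite (eq_bigr _ (fun j _ => step j)) -mulr_suml -/(dot w w); ring.
Qed.

End WaveIntegrals.

(** * Antiderivatives and the radial equation *)

Section Antiderivative.
Variable R : realType.
Local Notation leb := (@lebesgue_measure R).

Lemma antiderivative_ex (f : R -> R) : continuous f ->
  exists F : R -> R, (forall t : R, is_derive t (1 : R) F (f t)) /\ F 1 = 0.
Proof.
move=> cf.
have fi (a b : R) : leb.-integrable `[a, b] (EFin \o f).
  by apply: continuous_compact_integrable; [exact: segment_compact|exact: continuous_subspaceT].
(* For [a] below both 1 and [t] this is the signed integral from 1 to [t], on either side of 1, and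
   it does not depend on [a]. *)
pose G (a t : R) : R := \int[leb]_(s in `[a, t]) f s - \int[leb]_(s in `[a, 1]) f s.
have chasles (a b x : R) : a <= b -> b <= x ->
    \int[leb]_(s in `[a, x]) f s = \int[leb]_(s in `[a, b]) f s + \int[leb]_(s in `[b, x]) f s.
  move=> ab bx; have := @Rintegral_itvB R f (BLeft a) (BRight x) b (fi a x).
  rewrite !bnd_simp => /(_ ab bx) e1.
  have := @Rintegral_itvB R f (BLeft b) (BRight x) b (fi b x).
  rewrite !bnd_simp => /(_ isT bx); rewrite set_itv1 Rintegral_set1 subr0 => ->.
  by rewrite -e1 addrC subrK.
have GE (a b t : R) : a <= b -> b <= t -> b <= 1 -> G a t = G b t.
  by move=> ab bt b1; rewrite /G (chasles a b t) // (chasles a b 1) //; ring.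
exists (fun t => G (Num.min t 1 - 1) t); split=> [t|]; last exact: subrr.
(* A fixed base point to the left of the moving ones [Num.min s 1 - 1] for all s > t - 1, so that
   the derivative at [t] can be taken with [a] constant. *)
pose a := Num.min t 1 - 2.
apply: (@near_eq_is_derive _ _ _ (G a)).
  near=> s; have st : t - 1 < s.
    by near: s; apply: lt_nbhsr; rewrite ltrBlDr ltrDl.
  have minl (x : R) : Num.min x 1 <= x by rewrite ge_min lexx.
  have minr (x : R) : Num.min x 1 <= 1 by rewrite ge_min lexx orbT.
  have := minl t; have := minr t; have := minl s; have := minr s.
  move=> s1 ss t1 tt; apply: GE; [|by lra..].
  have : Num.min t 1 - 1 <= Num.min s 1 by rewrite le_min; apply/andP; split; lra.
  by rewrite /a; lra.
have at_ : a < t by rewrite /a ltrBlDr gt_min; apply/orP; left; lra.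
have [dF FE] : derivable (fun x => \int[leb]_(s in `[a, x]) f s) t 1 /\
    derive1 (fun x => \int[leb]_(s in `[a, x]) f s) t = f t.
  apply: (@continuous_FTC1 R f (BLeft a) t (t + 1)); [by rewrite ltrDl|exact: fi| |exact: cf].
  exact: at_.
have h : is_derive t (1 : R) (fun x => \int[leb]_(s in `[a, x]) f s) (f t).
  by rewrite derive1E in FE; exact: DeriveDef dF FE.
have := is_deriveD h (is_derive_cst (- \int[leb]_(s in `[a, 1]) f s) t (1 : R)).
by rewrite addr0.
Unshelve. all: end_near. Qed.

Definition antiderivative (f : R -> R) : R -> R :=
  xget f [set F | (forall t : R, is_derive t (1 : R) F (f t)) /\ F 1 = 0].

Lemma antiderivatives_iter (f : R -> R) : continuous f ->
  antiderivatives (fun j => iter j antiderivative f).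
Proof.
move=> cf; have step g : continuous g ->
    (forall t : R, is_derive t (1 : R) (antiderivative g) (g t)) /\ antiderivative g 1 = 0.
  move=> cg; have [F hF] := antiderivative_ex cg.
  by have := @xgetPex _ g [set F | (forall t : R, is_derive t (1 : R) F (g t)) /\ F 1 = 0]; apply; exists F.
split=> // j; apply: (step _); elim: j => [|j IH] //.
exact: continuous_derive (step _ IH).1.
Qed.

End Antiderivative.

(** * Uniqueness for the singular radial equation *)

Section RadialEquation.
Variable R : realType.
Implicit Types (b chi nu s t : R).

(** The product of [E] with [expR (- C * s)] is nonincreasing from 0, yet nonnegative. *)
Lemma gronwall_eq0 (E dE : R -> R) (C r : R) :
  (forall s, is_derive s (1 : R) E (dE s)) ->
  (forall s, 0 <= s <= r -> dE s <= C * E s) ->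
  (forall s, 0 <= E s) -> E 0 = 0 -> forall s, 0 <= s <= r -> E s = 0.
Proof.
move=> hE dEC E0 E00 s /andP[s0 sr].
pose F (u : R) := E u * expR (- C * u).
have hF (u : R) : is_derive u (1 : R) F ((dE u - C * E u) * expR (- C * u)).
  have h1 : is_derive u (1 : R) (fun u => - C * u) (- C * 1).
    exact: (is_deriveZ (- C) (is_derive_id u (1 : R))).
  have h2 := is_derive1_comp (is_derive_expR (- C * u)) h1.
  apply: is_derive_eq (is_deriveM (hE u) h2) _.
  by rewrite /GRing.scale /=; ring.
have cF := continuous_derive hF.
have : F s <= F 0.
  apply: (@ler0_derive1_nincr R F 0 s) => //.
  - move=> u; rewrite in_itv /= => /andP[u0 us]; rewrite derive1E.
    have [_ ->] := hF u; rewrite mulr_le0_ge0 ?expR_ge0 // subr_le0 dEC //.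
    by rewrite ltW //= (le_trans (ltW us) sr).
  - by apply: continuous_subspaceT.
rewrite /F E00 mul0r pmulr_lle0 ?expR_gt0 // => Es.
by apply/eqP; rewrite eq_le Es E0.
Qed.

(* The equation [(1-s^2)(f'' + (2 nu - 1) f'/s) - 2 s f' = (b s^2 - chi) f], which
   is singular at [s = 0], in terms of [h = f], [h1 = 2 f'/(b s)] and
   [h2 = 2 h1'/(b s)]. *)
Definition radial_system b chi nu (h h1 h2 : R -> R) : Prop := [/\
  (forall s, is_derive s (1 : R) h (b / 2 * s * h1 s)),
  (forall s, is_derive s (1 : R) h1 (b / 2 * s * h2 s)) &
  (forall s, 0 <= s <= 1 -> chi * h s = b * s ^+ 2 * h s +
     b * (s ^+ 2 * (nu + 1) - nu) * h1 s -
     b ^+ 2 / 4 * s ^+ 2 * (1 - s ^+ 2) * h2 s)].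

(* With [p = h' = (b/2) s h1], the equation reads
   [(1-s^2) p' = (b s^2 - chi) h - b (nu - 1/2) (1-s^2) h1 + 2 s p]; the term that
   is singular at [s = 0] has a favourable sign in the energy [h^2 + p^2]. *)
Lemma radial_system_unique b chi nu (h h1 h2 : R -> R) : 0 < b -> 2^-1 <= nu ->
  radial_system b chi nu h h1 h2 ->
  h 0 = 0 -> forall s, 0 <= s <= 1 -> h s = 0.
Proof.
move=> b0 nu2 [hh hh1 eqn] h0.
pose p (s : R) := b / 2 * s * h1 s.
pose dp (s : R) := b / 2 * h1 s + b / 2 * s * (b / 2 * s * h2 s).
have hp (s : R) : is_derive s (1 : R) p (dp s).
  have h3 : is_derive s (1 : R) (fun u => b / 2 * u) (b / 2 * 1).
    exact: (is_deriveZ (b / 2) (is_derive_id s (1 : R))).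
  apply: is_derive_eq (is_deriveM h3 (hh1 s)) _.
  by rewrite /GRing.scale /= /dp; ring.
have lt1 (r : R) : 0 <= r -> r < 1 -> h r = 0.
  (* The numerator adds up the three bounds below: 1 from [q1], [b + |chi|] from [q2] and 4 from
     [q3]. The denominator tends to 0 as r tends to 1, hence the restriction to r < 1. *)
  move=> r0 r1; pose C := (`|chi| + b + 5) / (1 - r ^+ 2).
  have r2 : 0 < 1 - r ^+ 2 by rewrite subr_gt0 expr_lt1.
  pose E (s : R) := h s ^+ 2 + p s ^+ 2.
  pose dE (s : R) := 2 * h s * p s + 2 * p s * dp s.
  have hE (s : R) : is_derive s (1 : R) E (dE s).
    have e2 : E = fun u => h u * h u + p u * p u by apply/funext => u; rewrite /E !expr2.
    rewrite e2; apply: is_derive_eq (is_deriveD (is_deriveM (hh s) (hh s)) (is_deriveM (hp s) (hp s))) _.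
    by rewrite /GRing.scale /= /dE /p; ring.
  have E0 s : 0 <= E s by rewrite addr_ge0 ?sqr_ge0.
  have dEC s : 0 <= s <= r -> dE s <= C * E s.
    move=> /andP[s0 sr]; have s2r : s ^+ 2 <= r ^+ 2 by rewrite ler_pXn2r ?nnegrE.
    have s2 : 0 < 1 - s ^+ 2 by apply: lt_le_trans r2 _; rewrite lerD2l lerN2.
    have s1 : s <= 1 by rewrite (le_trans sr) // ltW.
    have s01 : 0 <= s <= 1 by rewrite s0.
    have key : (1 - s ^+ 2) * dE s <= (`|chi| + b + 5) * E s.
      (* The last summand is 2 p times the defect of the third equation, hence 0; including it
         eliminates [h2]. *)
      have -> : (1 - s ^+ 2) * dE s = 2 * (1 - s ^+ 2) * h s * p s +
         2 * (b * s ^+ 2 - chi) * (h s * p s) + 4 * s * p s ^+ 2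
         - b ^+ 2 * (nu - 2^-1) * (1 - s ^+ 2) * s * h1 s ^+ 2
         + 4 * (2^-1 * p s) * (chi * h s - (b * s ^+ 2 * h s +
     b * (s ^+ 2 * (nu + 1) - nu) * h1 s -
     b ^+ 2 / 4 * s ^+ 2 * (1 - s ^+ 2) * h2 s)).
        by rewrite /dE /dp /p; field.
      rewrite -eqn // subrr mulr0 addr0.
      have sing : 0 <= b ^+ 2 * (nu - 2^-1) * (1 - s ^+ 2) * s * h1 s ^+ 2.
        rewrite mulr_ge0 ?sqr_ge0 // mulr_ge0 // mulr_ge0 ?(ltW s2) //.
        by rewrite mulr_ge0 ?sqr_ge0 // subr_ge0.
      have hpE : `|h s * p s| <= E s / 2.
        rewrite /E ler_norml; have := sqr_ge0 (h s - p s); have := sqr_ge0 (h s + p s).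
        by rewrite sqrrD sqrrB; lra.
      have pE : p s ^+ 2 <= E s by rewrite lerDr sqr_ge0.
      have q1 : 2 * (1 - s ^+ 2) * h s * p s <= E s.
        have : (1 - s ^+ 2) * (h s * p s) <= 1 * `|h s * p s|.
          apply: le_trans (ler_norm _) _; rewrite normrM ler_wpM2r //.
          by rewrite (ger0_norm (ltW s2)) lerBlDr lerDl sqr_ge0.
        by lra.
      have q2 : 2 * (b * s ^+ 2 - chi) * (h s * p s) <= (b + `|chi|) * E s.
        have : (b * s ^+ 2 - chi) * (h s * p s) <= (b + `|chi|) * (E s / 2).
          apply: le_trans (ler_norm _) _; rewrite normrM ler_pM //.
          apply: le_trans (ler_normB _ _) _; rewrite lerD2r.
          rewrite ger0_norm; last by rewrite mulr_ge0 ?sqr_ge0 // ltW.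
          by rewrite ger_pMr // expr_le1.
        by lra.
      have q3 : 4 * s * p s ^+ 2 <= 4 * E s.
        rewrite -mulrA ler_pM2l //; apply: le_trans pE; rewrite -[leRHS]mul1r.
        by rewrite ler_wpM2r ?sqr_ge0.
      by lra.
    (* Passing from 1 - s^2 to the smaller 1 - r^2 preserves the bound when [dE s] is nonnegative;
       otherwise the bound is trivial. *)
    rewrite /C mulrAC ler_pdivlMr //; have [dE0|dE0] := leP 0 (dE s).
      apply: le_trans key; rewrite mulrC.
      by rewrite ler_wpM2r // lerD2l lerN2.
    apply: (@le_trans _ _ 0); first by rewrite mulr_le0_ge0 ?ltW.
    by rewrite mulr_ge0 ?E0 // !addr_ge0 // ltW.
  have Er : E r = 0.
    apply: (gronwall_eq0 hE dEC E0); last by rewrite r0 lexx.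
    by rewrite /E h0 /p mulr0 mul0r expr0n addr0.
  apply/eqP; rewrite -sqrf_eq0; apply/eqP.
  by apply: le_anti; rewrite sqr_ge0 andbT -Er lerDl sqr_ge0.
apply: (continuous_eq0_itv ltr01 (continuous_derive hh)) => s /andP[s0 s1].
exact: lt1 (ltW s0) s1.
Qed.

End RadialEquation.

(** * Repeated integration of the radial equation *)

Section AntiderivativeEquations.
Variables (R : realType) (U : nat -> R -> R) (P1 P2 : R -> R).
Hypotheses (hU : antiderivatives U)
  (hP1 : forall t : R, is_derive t (1 : R) (U 0%N) (P1 t))
  (hP2 : forall t : R, is_derive t (1 : R) P1 (P2 t)) (cP2 : continuous P2).

(** [P1] and [P2] stand for [U] at the indices -1 and -2. *)
Definition dU j : R -> R := if j is j'.+1 then U j' else P1.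
Definition d2U j : R -> R := if j is j'.+1 then dU j' else P2.

Lemma is_derive_U j (t : R) : is_derive t (1 : R) (U j) (dU j t).
Proof. by case: j => [|j]; [exact: hP1|exact: (hU.2 j).1]. Qed.

Lemma is_derive_dU j (t : R) : is_derive t (1 : R) (dU j) (d2U j t).
Proof. by case: j => [|j]; [exact: hP2|exact: is_derive_U]. Qed.

Lemma continuous_U j : continuous (U j).
Proof. exact: continuous_derive (is_derive_U j). Qed.

Lemma continuous_dU j : continuous (dU j).
Proof. exact: continuous_derive (is_derive_dU j). Qed.

Lemma continuous_d2U j : continuous (d2U j).
Proof. by case: j => [|j]; [exact: cP2|exact: continuous_dU]. Qed.

(** [U 0] may be nonzero at 1, but it only comes with the coefficient 0. *)
Lemma coefU1 j : j%:R * U j 1 = 0.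
Proof. by case: j => [|j]; rewrite ?mul0r // (hU.2 j).2 mulr0. Qed.

Variables (b al chi : R).

(** For j = 0 and al = 2m + 4k this is the radial part of L_c on P(|x|^2) Y(x). The other
    coefficients are forced by requiring each operator to be the derivative of the next; in
    particular t U_j - j U_(j+1) is the j-fold antiderivative of t U_0. *)
Definition radial_op j (t : R) : R :=
  - 4 * t * (1 - t) * d2U j t + (- (al - 4 * j%:R) + (al + 4 - 8 * j%:R) * t) * dU j t
  - j%:R * (al - 4 * j%:R) * U j t + b * (t * U j t - j%:R * U j.+1 t).

Lemma is_derive_radial_op j (t : R) :
  is_derive t (1 : R) (radial_op j.+1) (radial_op j t).
Proof.
pose u := al - 4 * j.+1%:R; pose v := al + 4 - 8 * j.+1%:R.
have hid := is_derive_id t (1 : R); have hc a := is_derive_cst (a : R) t (1 : R).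
have hq := is_derive_scale (- 4) (is_derive_mul hid (is_derive_sub (hc 1) hid)).
have hl := is_derive_add (hc (- u)) (is_derive_scale v hid).
have h1 := is_derive_mul hq (is_derive_dU j t).
have h2 := is_derive_mul hl (is_derive_U j t).
have h3 := is_derive_scale (j.+1%:R * u) (is_derive_U j.+1 t).
have h4 := is_derive_mul hid (is_derive_U j.+1 t).
have h5 := is_derive_scale j.+1%:R (is_derive_U j.+2 t).
have h6 := is_derive_scale b (is_derive_sub h4 h5).
have := is_derive_add (is_derive_sub (is_derive_add h1 h2) h3) h6.
rewrite (_ : (fun _ => _) = radial_op j.+1); last first.
  by apply/funext => s; rewrite /radial_op /= -/u -/v; ring.
move=> h; apply: (is_derive_eq h); rewrite /radial_op /u /v /= -!natr1; ring.
Qed.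

Lemma radial_op_eigen :
  (forall t, 0 <= t <= 1 -> radial_op 0 t = chi * U 0%N t) ->
  forall j t, 0 <= t <= 1 -> radial_op j t = chi * U j t.
Proof.
move=> h0; elim=> [//|j IH] t /andP[t0 t1].
pose g (s : R) := radial_op j.+1 s - chi * U j.+1 s.
have hg (s : R) : is_derive s (1 : R) g (radial_op j s - chi * U j s).
  exact: (is_deriveB (is_derive_radial_op j s) (is_deriveZ chi (is_derive_U j.+1 s))).
(* At 1 the coefficient of [U j], the first derivative of [U j.+1], is -4j, so [coefU1] applies; the
   second-order term vanishes with 1 - t. *)
have g1 : g 1 = 0.
  rewrite /g /radial_op (hU.2 j).2 (hU.2 j.+1).2 /= -natr1.
  by have := coefU1 j; move: (U j 1) => z; rewrite subrr; lra.
suff : g t = 0 by move/eqP; rewrite subr_eq0 => /eqP.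
have cg := continuous_derive hg.
have [s sI] := @MVT_segment R g _ t 1 t1 (fun s _ => hg s) (continuous_subspaceT cg).
rewrite IH ?subrr ?mul0r ?g1 => [/eqP|]; first by rewrite sub0r oppr_eq0 => /eqP.
by move: sI; rewrite in_itv /= => /andP[ts ->]; rewrite (le_trans t0 ts).
Qed.

End AntiderivativeEquations.

(** * The radial equation for the wave integral *)

Section RadialWaveIntegral.
Variables (R : realType) (m k : nat) (U : nat -> R -> R) (P1 P2 : R -> R).
Local Notation point := 'rV[R]_m.
Hypotheses (hm : (0 < m)%N) (hU : antiderivatives U)
  (hP1 : forall t : R, is_derive t (1 : R) (U 0%N) (P1 t))
  (hP2 : forall t : R, is_derive t (1 : R) P1 (P2 t)) (cP2 : continuous P2).
Variables (b chi : R).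
Hypotheses (b0 : 0 < b) (hP : forall t, 0 <= t <= 1 ->
  radial_op U P1 P2 b (2 * m%:R + 4 * k%:R) 0 t = chi * U 0%N t).
Local Notation nu := (m%:R / 2 + k%:R : R).
Local Notation dU := (dU U P1).
Local Notation d2U := (d2U U P1 P2).

(** The functions below satisfy X'' = V' = W and put the operator in the form -4 t W - 2 m V plus
    the terms in [b]. By [wave_int_mulX] the term in t W contributes 2 m V + q X, so V cancels and
    no derivative of [U k] is left. *)
Lemma wave_int_radial_op (x : point) th (q := dot x x) :
  chi * wave_int (U k) x th = q * (wave_int (U k) x th + (k%:R + 1) * wave_int (U k.+1) x th)
   + (b - q) * wave_int (fun t => t * U k t) x th - b * k%:R * wave_int (U k.+1) x th.
Proof.
have cU := continuous_U hU hP1; have cdU := continuous_dU hU hP1 hP2.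
have cd2U := continuous_d2U hU hP1 hP2 cP2.
pose W (t : R) := (1 - t) * d2U k t + (k%:R - 1) * dU k t.
pose V (t : R) := (1 - t) * dU k t + k%:R * U k t.
pose X (t : R) := (1 - t) * U k t + (k%:R + 1) * U k.+1 t.
have c1 : continuous (fun t : R => 1 - t).
  by move=> t; apply: cvgB; [exact: cvg_cst|exact: cvg_id].
have cM (f g : R -> R) : continuous f -> continuous g -> continuous (fun t => f t * g t).
  by move=> cf cg t; apply: cvgM; [exact: cf|exact: cg].
have cD (f g : R -> R) : continuous f -> continuous g -> continuous (fun t => f t + g t).
  by move=> cf cg t; apply: cvgD; [exact: cf|exact: cg].
have cC (a : R) : continuous (fun _ : R => a) by move=> t; exact: cvg_cst.
have cI : continuous (fun t : R => t) by move=> t; exact: cvg_id.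
have cW : continuous W by apply: cD; apply: cM.
have d1 t := is_derive_sub (is_derive_cst (1 : R) t (1 : R)) (is_derive_id t (1 : R)).
have hV t : is_derive t (1 : R) V (W t).
  have := is_derive_add (is_derive_mul (d1 t) (is_derive_dU hU hP1 hP2 k t))
    (is_derive_scale k%:R (is_derive_U hU hP1 k t)).
  by move=> h; apply: (is_derive_eq h); rewrite /W /=; ring.
have hX t : is_derive t (1 : R) X (V t).
  have := is_derive_add (is_derive_mul (d1 t) (is_derive_U hU hP1 k t))
    (is_derive_scale (k%:R + 1) (is_derive_U hU hP1 k.+1 t)).
  by move=> h; apply: (is_derive_eq h); rewrite /V /=; ring.
have cV := continuous_derive hV.
have V1 : V 1 = 0 by rewrite /V subrr mul0r add0r coefU1.
have X1 : X 1 = 0 by rewrite /X subrr mul0r add0r (hU.2 k).2 mulr0.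
have eqW := wave_int_mulX x th cW hV V1 hX X1.
have ctU : continuous (fun t : R => t * U k t) by apply: cM.
have ctW : continuous (fun t : R => t * W t) by apply: cM.
have eqX : wave_int X x th = wave_int (U k) x th + (k%:R + 1) * wave_int (U k.+1) x th
    - wave_int (fun t => t * U k t) x th.
  have -> : X = fun t => (U k t + (k%:R + 1) * U k.+1 t) + -1 * (t * U k t).
    by apply/funext => t; rewrite /X; ring.
  rewrite !wave_intD ?wave_intZ //; first by ring.
  - exact: cM _ _ (cC _) (cU _).
  - exact: cD _ _ (cU _) (cM _ _ (cC _) (cU _)).
  - exact: cM _ _ (cC _) ctU.
have op : wave_int (fun t => chi * U k t) x th = wave_int (fun t => - 4 * (t * W t) +
    (- (2 * m%:R) * V t + (b * (t * U k t) + - (b * k%:R) * U k.+1 t))) x th.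
  apply: eq_wave_int => t t01.
  rewrite -(radial_op_eigen hU hP1 hP2 hP k t01) /radial_op /W /V; ring.
rewrite wave_intZ // in op; rewrite {}op !wave_intD ?wave_intZ //.
  by rewrite eqW eqX -/q; field.
- exact: cM _ _ (cC _) ctU.
- exact: cM _ _ (cC _) (cU _).
- exact: cM _ _ (cC _) cV.
- exact: cD _ _ (cM _ _ (cC _) ctU) (cM _ _ (cC _) (cU _)).
- exact: cM _ _ (cC _) ctW.
- exact: cD _ _ (cM _ _ (cC _) cV) (cD _ _ (cM _ _ (cC _) ctU) (cM _ _ (cC _) (cU _))).
Qed.

(** Here q = b s^2. The moment of t U_k that remains is removed by a second use of [wave_int_mulX],
    whose factor [m] brings [nu] back to m/2 + k. *)
Lemma radial_system_wave_int (w : point) th : dot w w = b ->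
  radial_system b chi nu (fun s => wave_int (U k) (s *: w) th)
    (fun s => wave_int (U k.+1) (s *: w) th) (fun s => wave_int (U k.+2) (s *: w) th).
Proof.
move=> wb; have cU := continuous_U hU hP1.
have ray j s : is_derive s (1 : R) (fun s => wave_int (U j) (s *: w) th)
    (b / 2 * s * wave_int (U j.+1) (s *: w) th).
  have h := is_derive_wave_int_ray w th s (hU.2 j).1 (cU j) (hU.2 j).2.
  by apply: (is_derive_eq h); rewrite wb; ring.
split; [exact: ray|exact: ray|move=> s s01; rewrite wave_int_radial_op].
rewrite (wave_int_mulX _ _ (cU k) (hU.2 k).1 (hU.2 k).2 (hU.2 k.+1).1 (hU.2 k.+1).2).
by rewrite dotZ wb; field.
Qed.

(** The factors 4 / b and 16 / b^2 come from the prescribed divisions by b s / 2, each derivative of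
    a function of s^2 contributing 2 s. *)
Lemma radial_system_profile : radial_system b chi nu (fun s => U 0%N (s ^+ 2))
  (fun s => 4 / b * P1 (s ^+ 2)) (fun s => 16 / b ^+ 2 * P2 (s ^+ 2)).
Proof.
have bn0 : b != 0 by rewrite gt_eqF.
have sq (f df : R -> R) s : (forall t : R, is_derive t (1 : R) f (df t)) ->
    is_derive s (1 : R) (fun s => f (s ^+ 2)) (2 * s * df (s ^+ 2)).
  move=> hf; have hid := is_derive_id s (1 : R).
  have h := is_derive1_comp (f := f) (g := fun s => s * s) (hf (s * s)) (is_derive_mul hid hid).
  have -> : (fun s => f (s ^+ 2)) = f \o (fun s => s * s).
    by apply/funext => u; rewrite /= expr2.
  by apply: (is_derive_eq h); rewrite expr2 /=; ring.
split=> s.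
- by have h := sq _ _ s hP1; apply: (is_derive_eq h); field.
- by have h := is_derive_scale (4 / b) (sq _ _ s hP2); apply: (is_derive_eq h); field.
- move=> /andP[s0 s1]; rewrite -hP; last by rewrite sqr_ge0 expr_le1.
  by rewrite /radial_op /=; field.
Qed.

Lemma wave_int_profile (w : point) th : dot w w = b ->
  (exists2 t, 0 <= t <= 1 & U 0%N t != 0) ->
  forall s, 0 <= s <= 1 -> wave_int (U k) (s *: w) th =
    wave_int (U k) (0 : point) th / U 0%N 0 * U 0%N (s ^+ 2).
Proof.
move=> wb [t0 /andP[t0_ge0 t0_le1] Ut0].
have nu2 : 2^-1 <= nu.
  have : 1 <= m%:R :> R by rewrite ler1n.
  by have : 0 <= k%:R :> R by []; lra.
have [hp hp1 eqp] := radial_system_profile.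
(* The same uniqueness result applied to the profile itself: were it 0 at the origin, it would
   vanish on [0,1]. *)
have U00 : U 0%N 0 != 0.
  apply: contra Ut0 => /eqP U00; apply/eqP.
  rewrite -(sqr_sqrtr t0_ge0).
  apply: (radial_system_unique b0 nu2 radial_system_profile).
    by rewrite expr0n.
  by rewrite sqrtr_ge0 -(@ler_pXn2r _ 2) ?nnegrE ?sqrtr_ge0 // sqr_sqrtr // expr1n.
set l := _ / _; have [hK hK1 eqK] := radial_system_wave_int th wb.
pose L (f g : R -> R) s := f s - l * g s.
move=> s s01; apply/eqP; rewrite -subr_eq0; apply/eqP.
apply: (@radial_system_unique R b chi nu
  (L (fun s => wave_int (U k) (s *: w) th) (fun s => U 0%N (s ^+ 2)))
  (L (fun s => wave_int (U k.+1) (s *: w) th) (fun s => 4 / b * P1 (s ^+ 2)))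
  (L (fun s => wave_int (U k.+2) (s *: w) th) (fun s => 16 / b ^+ 2 * P2 (s ^+ 2)))) => //.
- split=> u.
  + have h := is_derive_sub (hK u) (is_derive_scale l (hp u)).
    by apply: (is_derive_eq h); rewrite /L; ring.
  + have h := is_derive_sub (hK1 u) (is_derive_scale l (hp1 u)).
    by apply: (is_derive_eq h); rewrite /L; ring.
  + move=> u01; rewrite {1}/L mulrBr [chi * (l * _)]mulrCA (eqK _ u01) (eqp _ u01).
    by rewrite /L; ring.
- by rewrite /L scale0r expr0n /= /l divfK // subrr.
Qed.

End RadialWaveIntegral.

(** * Dirac operator and monogenic polynomials *)

Section Dirac.
Variables (R : realType) (m : nat).
Local Notation point := 'rV[R]_m.
Local Notation clR := (clifford R m).
Local Notation mpol := (mpoly.mpoly m R).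
Implicit Types (x y : point) (f : point -> clR).

Definition clpartial (j : 'I_m) f (df : point -> clR) : Prop :=
  forall A, partial j (fun y => f y A) (fun y => df y A).

Lemma dirac_opE f (df : 'I_m -> point -> clR) : (forall j, clpartial j f (df j)) ->
  forall x, dirac_op f x = \sum_j cle j * df j x.
Proof.
move=> hf x; apply: eq_bigr => j _; congr (_ * _); apply/ffunP => A.
by rewrite ffunE; have [_ ->] := hf j A x.
Qed.

Lemma clpartialM (u : point -> R) du j f df : partial j u du -> clpartial j f df ->
  clpartial j (fun y => u y *: f y) (fun y => du y *: f y + u y *: df y).
Proof.
move=> hu hf A x; rewrite (_ : (fun y => _) = fun y => u y * f y A); last first.
  by apply/funext => y; rewrite ffunE.
apply: is_derive_eq (partialM hu (hf A) x) _.
by rewrite !ffunE addrC mulrC.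
Qed.

Lemma clpartial_sum j (I : Type) (r : seq I) (F dF : I -> point -> clR) :
  (forall i, clpartial j (F i) (dF i)) ->
  clpartial j (fun y => \sum_(i <- r) F i y) (fun y => \sum_(i <- r) dF i y).
Proof.
move=> hF A x; have := @partial_sum R m j I r (fun i y => F i y A)
  (fun i y => dF i y A) (fun i => hF i A) x.
by rewrite (_ : (fun y => _) = fun y => (\sum_(i <- r) F i y) A) ?sum_ffunE //;
  apply/funext => y; rewrite sum_ffunE.
Qed.

Lemma clpartial_mull j (a : clR) f df : clpartial j f df ->
  clpartial j (fun y => a * f y) (fun y => a * df y).
Proof.
move=> hf A x.
have := @partial_sum R m j _ (index_enum {set 'I_m})
  (fun B y => (-1) ^+ clinv B (symdiff B A) * a B * f y (symdiff B A))
  (fun B y => (-1) ^+ clinv B (symdiff B A) * a B * df y (symdiff B A))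
  (fun B => partialZ _ (hf _)) x.
rewrite (_ : (fun y => _) = fun y => (a * f y) A); last first.
  by apply/funext => y; rewrite clmulE; apply: eq_bigr => B _; rewrite mulrA.
by move=> h; apply: (is_derive_eq h); rewrite clmulE; apply: eq_bigr => B _; rewrite mulrA.
Qed.

Definition clvec y : clR := \sum_j y 0 j *: cle j.

Lemma cle_clvec i y : cle i * clvec y = - (clvec y * cle i) - (2 * y 0 i) *: 1.
Proof.
rewrite /clvec mulr_sumr mulr_suml (bigD1 i) //= [in RHS](bigD1 i) //=.
rewrite -clscalerAl -clscalerAr cle_sqr.
rewrite (eq_bigr (fun j => - (y 0 j *: cle j * cle i))) => [|j ji]; last first.
  by rewrite -clscalerAl -clscalerAr cle_anticomm 1?eq_sym // scalerN.
rewrite sumrN; set S := \sum_(j | _) _.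
rewrite (_ : 2 * y 0 i = y 0 i + y 0 i) ?scalerDl; last by ring.
by rewrite !scalerN !opprD opprK addrA [_ - S - _]addrAC subrr sub0r addrC.
Qed.

End Dirac.

Section Monogenic.
Variables (R : realType) (m : nat).
Local Notation point := 'rV[R]_m.
Local Notation clR := (clifford R m).
Local Notation mpol := (mpoly.mpoly m R).
Implicit Types (x y : point) (q : {set 'I_m} -> mpol).

Definition polycl q y : clR := [ffun A => polyf (q A) y].

Definition clderiv j q (A : {set 'I_m}) : mpol := mpoly.mderiv j (q A).

Definition monogenic q : Prop := forall x, \sum_j cle j * polycl (clderiv j q) x = 0.

Lemma clpartial_polycl j q : clpartial j (polycl q) (polycl (clderiv j q)).
Proof.
move=> A x; rewrite (_ : (fun y => _) = polyf (q A)); last first.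
  by apply/funext => y; rewrite ffunE.
by rewrite ffunE; exact: partial_polyf.
Qed.

Lemma dirac_polycl q x : dirac_op (polycl q) x = \sum_j cle j * polycl (clderiv j q) x.
Proof. exact: dirac_opE (fun j => clpartial_polycl j q) x. Qed.

(** Applying the Dirac operator twice gives the sum of e_i e_j times the second derivatives. Added
    to its transpose, the off-diagonal terms cancel by anticommutation, and e_i^2 = -1 leaves minus
    twice the Laplacian. *)
Lemma monogenic_harmonic q : monogenic q -> forall A, harmonic_poly (q A).
Proof.
move=> hq; pose D i j := polycl (clderiv i (clderiv j q)).
have D0 i x : \sum_j cle j * D i j x = 0.
  have h := clpartial_sum (index_enum 'I_m)
    (fun j => clpartial_mull (cle j) (clpartial_polycl i (clderiv j q))).
  apply/ffunP => A; have := h A x.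
  rewrite (_ : (fun y => _) = cst 0); last first.
    by apply/funext => y; rewrite hq ffunE.
  by move=> [_ <-]; rewrite derive_cst ffunE.
have DC i j x : D i j x = D j i x.
  by apply/ffunP => A; rewrite !ffunE /clderiv mpoly.mderiv_comm.
have sum0 x : \sum_i \sum_j (cle i * cle j) * D i j x = 0.
  rewrite big1 // => i _; transitivity (cle i * \sum_j cle j * D i j x).
    by rewrite mulr_sumr; apply: eq_bigr => j _; rewrite mulrA.
  by rewrite D0 mulr0.
have sum2 x : \sum_i ((cle i * cle i) * D i i x + (cle i * cle i) * D i i x) = 0.
  have e : \sum_i \sum_j (cle i * cle j) * D i j x + \sum_i \sum_j (cle j * cle i) * D i j x = 0.
    rewrite sum0 add0r exchange_big /=; apply: etrans (sum0 x).
    by apply: eq_bigr => i _; apply: eq_bigr => j _; rewrite DC.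
  apply: etrans e; rewrite -big_split /=; apply: eq_bigr => i _.
  rewrite -big_split /= (bigD1 i) //= big1 ?addr0 // => j ji.
  by rewrite -mulrDl (cle_anticomm _ ji) subrr mul0r.
move=> A x; have /ffunP /(_ A) := sum2 x; rewrite sum_ffunE ffunE => e.
have -> : \sum_j polyf (mpoly.mderiv j (mpoly.mderiv j (q A))) x =
   - 2^-1 * \sum_i ((cle i * cle i) * D i i x + (cle i * cle i) * D i i x) A.
  rewrite mulr_sumr; apply: eq_bigr => i _; rewrite cle_sqr mulN1r !ffunE /clderiv.
  by field.
by rewrite e mulr0.
Qed.

(** Multiplying [cle_clvec] by y_i and summing gives X^2 = -X^2 - 2 |y|^2. *)
Lemma clvec_sqr y : clvec y * clvec y = - (dot y y *: 1).
Proof.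
have e : clvec y * clvec y = - (clvec y * clvec y) - (2 * dot y y) *: 1.
  transitivity (\sum_i (- (clvec y * (y 0 i *: cle i)) - (2 * (y 0 i * y 0 i)) *: (1 : clR))).
    rewrite {1}/clvec mulr_suml; apply: eq_bigr => i _.
    rewrite -clscalerAl cle_clvec scalerBr scalerN clscalerAr scalerA.
    by rewrite mulrCA.
  by rewrite sumrB sumrN -mulr_sumr -scaler_suml -mulr_sumr.
have two0 : (2 : R) != 0 by rewrite pnatr_eq0.
apply: (scalerI two0); rewrite scalerN scalerA scaler_nat mulr2n {1}e.
by rewrite addrAC addNr add0r.
Qed.

Lemma clpartial_clvecM i q : clpartial i (fun y => clvec y * polycl q y)
  (fun y => cle i * polycl q y + clvec y * polycl (clderiv i q) y).
Proof.
move=> A x.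
have h := clpartial_sum (index_enum 'I_m) (fun j => clpartialM (partial_coord j i)
  (clpartial_mull (cle j) (clpartial_polycl i q))).
have e (f : point -> clR) y : clvec y * f y = \sum_j y 0 j *: (cle j * f y).
  by rewrite /clvec mulr_suml; apply: eq_bigr => j _; rewrite clscalerAl.
have := h A x; rewrite (_ : (fun y => _) = (fun y => (clvec y * polycl q y) A)); last first.
  by apply/funext => y; rewrite e.
move=> h2; apply: (is_derive_eq h2); rewrite big_split /= -e.
congr (fun_of_fin (_ + _) A).
rewrite (bigD1 i) //= eqxx scale1r big1 ?addr0 // => j /negPf ->.
by rewrite scale0r.
Qed.

Lemma dirac_radial (P P1 : R -> R) q : monogenic q ->
  (forall t : R, is_derive t (1 : R) P (P1 t)) ->
  forall y, dirac_op (radial P (polycl q)) y =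
    (2 * P1 (dot y y)) *: (clvec y * polycl q y).
Proof.
move=> hq hP y; rewrite (dirac_opE (fun j => clpartialM
  (partial_comp hP (partial_sqnorm j)) (clpartial_polycl j q))).
transitivity (\sum_j ((2 * P1 (dot y y)) *: (y 0 j *: cle j * polycl q y) +
    P (dot y y) *: (cle j * polycl (clderiv j q) y))).
  apply: eq_bigr => j _; rewrite mulrDr -!clscalerAr; congr (_ + _).
  by rewrite -clscalerAl scalerA; congr (_ *: _); ring.
by rewrite big_split /= -!scaler_sumr hq scaler0 addr0 -mulr_suml.
Qed.

(* The identity [d_x (x Y) = -(m + 2k) Y] for [Y] monogenic of degree [k]. *)
Lemma dirac_radial_clvec (F F1 : R -> R) k q : monogenic q ->
  (forall A, homogeneous k (q A)) ->
  (forall t : R, is_derive t (1 : R) F (F1 t)) ->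
  forall y, dirac_op (fun y => F (dot y y) *: (clvec y * polycl q y)) y =
    - (2 * dot y y * F1 (dot y y) + (m%:R + 2 * k%:R) * F (dot y y)) *: polycl q y.
Proof.
move=> hq kq hF y; rewrite (dirac_opE (fun j => clpartialM
  (partial_comp hF (partial_sqnorm j)) (clpartial_clvecM j q))).
set X := clvec y; set Y := polycl q y; pose D j := polycl (clderiv j q) y.
have euler : \sum_j y 0 j *: D j = k%:R *: Y.
  apply/ffunP => A; rewrite sum_ffunE !ffunE.
  rewrite -[RHS](euler_identity y (kq A)); apply: eq_bigr => j _.
  by rewrite !ffunE.
(* Each e_j is moved past the vector: e_j e_j Y gives -Y, and e_j X = -X e_j - 2 y_j. After
   summation these contribute -m Y, 0 by monogenicity and -2k Y by Euler's identity. *)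
transitivity (\sum_j ((2 * F1 (dot y y)) *: (y 0 j *: cle j * (X * Y)) +
    F (dot y y) *: (- Y - X * (cle j * D j) - 2 *: (y 0 j *: D j)))).
  apply: eq_bigr => j _; rewrite mulrDr -!clscalerAr; congr (_ + _).
    by rewrite -clscalerAl scalerA; congr (_ *: _); ring.
  congr (_ *: _); rewrite mulrDr !mulrA cle_sqr mulN1r cle_clvec -/X -/(D j).
  by rewrite mulrBl mulNr -clscalerAl mul1r -scalerA addrA.
rewrite big_split /= -!scaler_sumr -mulr_suml -/(clvec y) -/X mulrA clvec_sqr.
rewrite !sumrB -scaler_sumr euler -mulr_sumr hq mulr0 subr0 sumr_const card_ord.
rewrite mulNr -clscalerAl mul1r -(scaler_nat m (- Y)); apply/ffunP => A; rewrite !ffunE.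
have scE (a b : R) : a *: (b : R^o) = a * b by [].
by rewrite !scE; ring.
Qed.

Lemma Lc_radial (P P1 P2 : R -> R) (c : R) k q : monogenic q ->
  (forall A, homogeneous k (q A)) ->
  (forall t : R, is_derive t (1 : R) P (P1 t)) ->
  (forall t : R, is_derive t (1 : R) P1 (P2 t)) ->
  forall y (t := dot y y), Lc c (radial P (polycl q)) y =
    (- 4 * t * (1 - t) * P2 t + (- (2 * m%:R + 4 * k%:R) + (2 * m%:R + 4 * k%:R + 4) * t) * P1 t
     + 4 * pi ^+ 2 * c ^+ 2 * t * P t) *: polycl q y.
Proof.
(* The inner factor (1 - |y|^2) times the Dirac derivative is F(|y|^2) y Y(y), to which
   [dirac_radial_clvec] applies. *)
move=> hq kq hP hP1 y t; pose F s := 2 * ((1 - s) * P1 s).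
pose F1 s := 2 * ((1 - s) * P2 s + P1 s * (0 - 1)).
have hF (s : R) : is_derive s (1 : R) F (F1 s).
  have d1 := is_derive_sub (is_derive_cst (1 : R) s (1 : R)) (is_derive_id s (1 : R)).
  exact: is_derive_scale 2 (is_derive_mul d1 (hP1 s)).
rewrite /Lc (_ : (fun y => _) = fun y => F (dot y y) *: (clvec y * polycl q y)); last first.
  apply/funext => z; rewrite (dirac_radial hq hP) scalerA; congr (_ *: _).
  by rewrite /F; ring.
rewrite (dirac_radial_clvec hq kq hF) /radial scalerA -scalerDl -/t; congr (_ *: _).
by rewrite /F /F1; ring.
Qed.

End Monogenic.

(** * Eigenfunctions *)

Section Eigenfunctions.
Variables (R : realType) (m : nat).
Local Notation point := 'rV[R]_m.
Local Notation mpol := (mpoly.mpoly m R).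
Local Notation ball_int := (int_rV (@B1 R m)).
Implicit Types (x y w : point).

Lemma polar_decomposition x : (0 < m)%N ->
  exists w, dot w w = 1 /\ x = Num.sqrt (dot x x) *: w.
Proof.
move=> hm; have [x0|x0] := eqVneq (dot x x) 0.
  exists (delta_mx 0 (Ordinal hm)); rewrite x0 sqrtr0 scale0r; split; last exact: dot_eq0.
  rewrite /dot (bigD1 (Ordinal hm)) //= big1 ?addr0 ?mxE ?eqxx ?mulr1 // => j /negPf jh.
  by rewrite mxE jh andbF mulr0.
have r0 : Num.sqrt (dot x x) != 0 by rewrite gt_eqF // sqrtr_gt0 lt_neqAle eq_sym x0 dot_ge0.
exists ((Num.sqrt (dot x x))^-1 *: x); rewrite scalerA divff // scale1r; split=> //.
by rewrite dotZ exprVn sqr_sqrtr ?dot_ge0 // mulVf.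
Qed.

Lemma homogeneous_unit_neq0 k (p : mpol) x : (0 < m)%N -> homogeneous k p ->
  polyf p x != 0 -> exists w, dot w w = 1 /\ polyf p w != 0.
Proof.
move=> hm hp; have [w [w1 ->]] := polar_decomposition x hm.
by rewrite (polyf_homogeneousZ _ _ hp) mulf_eq0 negb_or => /andP[_ h]; exists w.
Qed.

(** At the point [Num.sqrt t *: w] the component [A] of the equation is the scalar equation times
    [Num.sqrt t ^+ k * polyf (q A) w], which is nonzero for t > 0. *)
Lemma eigenfunction_radial_op (U : nat -> R -> R) (P1 P2 : R -> R) (c chi : R) k
    (q : {set 'I_m} -> mpol) w A :
  (forall t : R, is_derive t (1 : R) (U 0%N) (P1 t)) ->
  (forall t : R, is_derive t (1 : R) P1 (P2 t)) -> continuous P2 ->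
  monogenic q -> (forall A, homogeneous k (q A)) ->
  dot w w = 1 -> polyf (q A) w != 0 ->
  (forall x, B1 x -> Lc c (radial (U 0%N) (polycl q)) x = chi *: radial (U 0%N) (polycl q) x) ->
  forall t, 0 <= t <= 1 ->
  radial_op U P1 P2 (4 * pi ^+ 2 * c ^+ 2) (2 * m%:R + 4 * k%:R) 0 t = chi * U 0%N t.
Proof.
move=> hP hP1 cP2 hq kq w1 qw eqn.
set b := 4 * _ * _; set al := 2 * _ + _.
pose g (t : R) := - 4 * (t * (1 - t)) * P2 t + (- al + (al + 4) * t) * P1 t
   + b * (t * U 0%N t) - chi * U 0%N t.
have gE t : radial_op U P1 P2 b al 0 t - chi * U 0%N t = g t.
  by rewrite /radial_op /g /=; ring.
move=> t t01; apply/eqP; rewrite -subr_eq0 gE; apply/eqP.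
have cg : continuous g.
  have cU := continuous_derive hP; have cP1 := continuous_derive hP1.
  move=> s; apply: cvgB; last by apply: cvgM; [exact: cvg_cst|exact: cU].
  apply: cvgD; last first.
    by apply: cvgM; [exact: cvg_cst|apply: cvgM; [exact: cvg_id|exact: cU]].
  apply: cvgD; apply: cvgM; [|exact: cP2| |exact: cP1].
    apply: cvgM; [exact: cvg_cst|apply: cvgM; [exact: cvg_id|]].
    by apply: cvgB; [exact: cvg_cst|exact: cvg_id].
  by apply: cvgD; [exact: cvg_cst|apply: cvgM; [exact: cvg_cst|exact: cvg_id]].
move: t t01; apply: (continuous_eq0_itv ltr01 cg) => t /andP[t0 t1].
have xt : dot (Num.sqrt t *: w) (Num.sqrt t *: w) = t.
  by rewrite dotZ w1 mulr1 sqr_sqrtr // ltW.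
have Bx : B1 (Num.sqrt t *: w) by rewrite /B1 /= xt ltW.
have := eqn _ Bx; rewrite (Lc_radial c hq kq hP hP1) xt /radial xt.
move=> /ffunP /(_ A); rewrite !ffunE (polyf_homogeneousZ _ _ (kq A)).
have scE (u v : R) : u *: (v : R^o) = u * v by [].
have Y0 : Num.sqrt t ^+ k * polyf (q A) w != 0.
  by rewrite mulf_neq0 // expf_neq0 // gt_eqF // sqrtr_gt0.
rewrite !scE => e; rewrite -gE; apply/eqP; rewrite subr_eq0; apply/eqP/(mulIf Y0).
by rewrite -[RHS]mulrA -e /radial_op /b /al /=; ring.
Qed.

(** The multiplier depends on [p] through its degree only, so it is common to all components of the
    Clifford-valued function. *)
Lemma ball_eigen (U : nat -> R -> R) (P1 P2 : R -> R) (a chi : R) k (p : mpol) :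
  (0 < m)%N -> antiderivatives U ->
  (forall t : R, is_derive t (1 : R) (U 0%N) (P1 t)) ->
  (forall t : R, is_derive t (1 : R) P1 (P2 t)) -> continuous P2 -> 0 < a ->
  (forall t, 0 <= t <= 1 ->
    radial_op U P1 P2 (a ^+ 2) (2 * m%:R + 4 * k%:R) 0 t = chi * U 0%N t) ->
  (exists2 t, 0 <= t <= 1 & U 0%N t != 0) ->
  homogeneous k p -> harmonic_poly p -> forall th x, B1 x ->
  ball_int (fun y => U 0%N (dot y y) * (wave (a *: x) th y * polyf p y)) =
  (- 2^-1) ^+ k * a ^+ k *
  (wave_int (U k) (0 : point) (th + k%:R * (pi / 2)) / U 0%N 0) *
  (U 0%N (dot x x) * polyf p x).
Proof.
move=> hm hU hP1 hP2 cP2 a0 hP nz kp hp th x Bx.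
rewrite (ball_harmonic hU 0 (a *: x) th kp hp) add0n (polyf_homogeneousZ _ _ kp).
have [w [w1 xw]] := polar_decomposition x hm.
have wb : dot (a *: w) (a *: w) = a ^+ 2 by rewrite dotZ w1 mulr1.
have s01 : 0 <= Num.sqrt (dot x x) <= 1.
  rewrite sqrtr_ge0 -(@ler_pXn2r _ 2) ?nnegrE ?sqrtr_ge0 // sqr_sqrtr ?dot_ge0 //.
  by rewrite expr1n.
have := wave_int_profile hm hU hP1 hP2 cP2 (exprn_gt0 2 a0) hP
  (th + k%:R * (pi / 2)) wb nz s01.
rewrite sqr_sqrtr ?dot_ge0 // scalerA mulrC -scalerA -xw /wave_int => ->.
by ring.
Qed.

End Eigenfunctions.


Theorem theorem5p8 (R : realType) (m : nat) (c : R) (hm : (2 <= m)%N)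
    (hc : 0 < c) (N k : nat) (Y : 'I_(dimM m k) -> 'rV[R]_m -> clifford R m)
    (hY : is_basis_Mplus Y) (hYo : orthonormal_sphere Y) (i : 'I_(dimM m k))
    (psi : 'rV[R]_m -> clifford R m) (hpsi : even_cpswf c (Y i) N psi) :
  exists mu : R[i], forall x : 'rV[R]_m, B1 x ->
    Gc c (fun y => clcomplex (psi y)) x = mu *: clcomplex (psi x).
Proof.
have m0 : (0 < m)%N by exact: ltnW.
have [chi [P [_ [sP nzP eigP] psiE psi1]]] := hpsi.
have [/(_ i)[homY monY] _] := hY.
have /choice[q hq] : forall A, exists p : mpoly.mpoly m R,
    homogeneous k p /\ (forall x, Y i x A = polyf p x).
  move=> A; have [p pE] := homY A; exists (mpoly.mpoly_of_dhomog p).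
  by split; [exact: homogeneous_dhomog|exact: pE].
have kq A := (hq A).1.
have YE : Y i = polycl q.
  by apply/funext => x; apply/ffunP => A; rewrite ffunE (hq A).2.
rewrite YE in monY eigP psiE.
have mq : monogenic q by move=> x; rewrite -dirac_polycl.
have derP n (t : R) : is_derive t (1 : R) (derive1n n P) (derive1n n.+1 P t).
  by apply: DeriveDef; [exact: sP|rewrite derive1nS derive1E].
pose U j := iter j (@antiderivative R) P.
have hU : antiderivatives U by apply: antiderivatives_iter; exact: continuous_derive (derP 0%N).
have cP2 : continuous (derive1n 2 P) by exact: continuous_derive (derP 2%N).
(* The normalisation of [psi] excludes a zero [Y i]; homogeneity then moves a point of nonvanishing
   to the unit sphere. *)
have [A [w [w1 qw]]] : exists A w, dot w w = 1 /\ polyf (q A) w != 0.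
  apply: contrapT => none.
  have q0 A x : polyf (q A) x = 0.
    apply: contrapT => /eqP /(homogeneous_unit_neq0 m0 (kq A)) [w hw].
    by apply: none; exists A, w.
  have : int_rV (@B1 R m) (fun x => clscalar (clbar (psi x) * psi x)) = 0.
    rewrite (@eq_ball _ _ _ (fun y => 0 * cst 0 y)).
      by rewrite ballZ ?mul0r //; exact: tame_cst.
    move=> y By; have -> : psi y = 0.
      by rewrite psiE //; apply/ffunP => A; rewrite !ffunE q0 scaler0.
    by rewrite mulr0 mul0r /clscalar ffunE.
  by rewrite psi1 => /eqP; rewrite oner_eq0.
pose a := 2 * pi * c.
have a0 : 0 < a by rewrite !mulr_gt0 // pi_gt0.
have ode := eigenfunction_radial_op (U := U) (derP 0%N) (derP 1%N) cP2 mq kq w1 qw eigP.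
have ab : 4 * pi ^+ 2 * c ^+ 2 = a ^+ 2 by rewrite /a; ring.
rewrite ab in ode.
pose M th := (- 2^-1) ^+ k * a ^+ k *
  (wave_int (U k) (0 : 'rV[R]_m) (th + k%:R * (pi / 2)) / U 0%N 0).
have eig th x B : B1 x ->
    int_rV (@B1 R m) (fun y => wave (a *: x) th y * psi y B) = M th * psi x B.
  move=> Bx; rewrite psiE // !ffunE.
  rewrite -(ball_eigen m0 hU (derP 0%N) (derP 1%N) cP2 a0 ode nzP (kq B)
    (monogenic_harmonic mq B) th Bx).
  by apply: eq_ball => y By; rewrite psiE // !ffunE mulrCA.
(* [psi] has real components, so the cosine and the sine of the kernel give the real and imaginary
   parts of the multiplier. *)
exists (M 0 +i* M (- (pi / 2)))%C => x Bx; rewrite /Gc Bx.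
apply/ffunP => B; rewrite ffunE [RHS]ffunE.
rewrite (_ : clcomplex (psi x) B = (psi x B)%:C%C); last by rewrite ffunE.
have scE (u v : R[i]) : u *: (v : R[i]^o) = u * v by [].
rewrite scE /int_rVC; congr (_ +i* _)%C; rewrite ?mulr0 ?subr0 ?add0r ?addr0 -eig //.
- apply: eq_ball => y _; rewrite ffunE [clcomplex _ _]ffunE scE /wave dotZl addr0 /=.
  by rewrite mulr0 subr0.
- apply: eq_ball => y _; rewrite ffunE [clcomplex _ _]ffunE scE /wave dotZl /=.
  by rewrite cosBpihalf mulr0 add0r.
Qed.
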